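(* There is a randomized (sampling) algorithm which, given a set $X$ of $n$ points in the plane, no three of which are collinear, an integer $t$ with $0\le t<n/2$, and $\epsilon\in(0,1)$, with probability at least $1-3/n$ finds a rectangle (of arbitrary orientation) of area at most $\mathrm{opt}(X,t)$ such that the number of points of $X$ enclosed by it is between $(n-t)(1-\epsilon)$ and $n-t+1$, in time $$O\left(\left(\frac{\log n}{\epsilon^{2}}\right)^4\left(\frac{t}{n}+\epsilon\right)^3+n\right).$$
   Context: $\mathrm{opt}(X,t)$ denotes the minimum area of a rectangle that covers at least $n-t$ points of the planar set $X$ of $n$ points. Rectangles are closed regions (points on the sides and vertices count as enclosed) and may have any orientation. Running time is measured as usual in computational geometry (unit-cost arithmetic and comparisons on real coordinates); the constant in $O(\cdot)$ is absolute. *)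

(* Defs.v *)
From HB Require Import structures.
From mathcomp Require Import all_boot all_order all_algebra.
From mathcomp Require Import boolp classical_sets reals exp.

Set Implicit Arguments.
Unset Strict Implicit.
Unset Printing Implicit Defensive.

Import Order.TTheory GRing.Theory Num.Theory.

Local Open Scope ring_scope.

Section Geometry.
Variable R : realType.

Definition collinear (p q r : R * R) : Prop :=
  exists a b c : R, (a, b) != (0, 0) /\
    [/\ a * p.1 + b * p.2 = c, a * q.1 + b * q.2 = c & a * r.1 + b * r.2 = c].

Definition no_three_collinear (X : seq (R * R)) : Prop :=
  forall p q r, p \in X -> q \in X -> r \in X ->
    p != q -> p != r -> q != r -> ~ collinear p q r.

(* A rectangle is given by a vertex and the two side vectors issued from it.
   The sides may have length zero: segments and points are rectangles of area
   zero, so that a minimum area exists even for one or two points. *)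
Record rect := Rect { vertex : R * R; side1 : R * R; side2 : R * R }.

Definition is_rect (r : rect) : Prop :=
  (side1 r).1 * (side2 r).1 + (side1 r).2 * (side2 r).2 = 0.

Definition norm2 (u : R * R) : R := Num.sqrt (u.1 ^+ 2 + u.2 ^+ 2).

Definition area (r : rect) : R := norm2 (side1 r) * norm2 (side2 r).

Definition in_rect (r : rect) (q : R * R) : Prop :=
  exists a b : R, [/\ 0 <= a <= 1, 0 <= b <= 1,
    q.1 = (vertex r).1 + a * (side1 r).1 + b * (side2 r).1 &
    q.2 = (vertex r).2 + a * (side1 r).2 + b * (side2 r).2].

(* X is meant to be duplicate-free, so this is a cardinality. *)
Definition enclosed (r : rect) (X : seq (R * R)) : nat :=
  count (fun q => `[< in_rect r q >]) X.

(* The set is never empty and is bounded below by 0; the infimum is attained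
   because degenerate rectangles are allowed. *)
Definition opt (X : seq (R * R)) (t : nat) : R :=
  inf [set area r | r in [set r | is_rect r /\
                                  (size X - t <= enclosed r X)%N]].

End Geometry.

(* The randomized real RAM, presented as a while language.  The memory consists
   of integer arrays and real arrays, each of unbounded length; the names of the
   arrays are fixed in the program, the indices are computed.  Integers are
   natural numbers with addition and truncated subtraction only (no unit-cost
   multiplication or division, hence no packing of many values into one word);
   reals have the four field operations and comparisons, but no rounding to
   integers.  Programs contain no real constants, so the syntax does not depend
   on the field of reals. *)
Inductive iexp :=
  | INum of nat
  | IGet of nat & iexp
  | IAdd of iexp & iexp
  | ISub of iexp & iexp.

Inductive rexp :=
  | RGet of nat & iexp
  | ROfInt of iexp
  | RAdd of rexp & rexp
  | RSub of rexp & rexp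
  | RMul of rexp & rexp
  | RDiv of rexp & rexp.

Inductive bexp :=
  | ILt of iexp & iexp
  | RLt of rexp & rexp
  | BNot of bexp
  | BAnd of bexp & bexp.

Inductive cmd :=
  | Skip
  | ISet of nat & iexp & iexp   (* array, index, value *)
  | RSet of nat & iexp & rexp
  | IRand of nat & iexp & iexp  (* array, index, largest possible value *)
  | Seq of cmd & cmd
  | If of bexp & cmd & cmd
  | While of bexp & cmd.

Section Semantics.
Variable R : realType.

Record store := Store { imem : nat -> nat -> nat; rmem : nat -> nat -> R }.

Definition upd (T : Type) (m : nat -> nat -> T) (a i : nat) (v : T) :=
  fun a' i' => if (a' == a) && (i' == i) then v else m a' i'.

Definition iupd (s : store) a i v := Store (upd (imem s) a i v) (rmem s).
Definition rupd (s : store) a i v := Store (imem s) (upd (rmem s) a i v).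

Fixpoint ieval (s : store) (e : iexp) : nat :=
  match e with
  | INum k => k
  | IGet a i => imem s a (ieval s i)
  | IAdd e1 e2 => (ieval s e1 + ieval s e2)%N
  | ISub e1 e2 => (ieval s e1 - ieval s e2)%N
  end.

Fixpoint reval (s : store) (e : rexp) : R :=
  match e with
  | RGet a i => rmem s a (ieval s i)
  | ROfInt i => (ieval s i)%:R
  | RAdd e1 e2 => reval s e1 + reval s e2
  | RSub e1 e2 => reval s e1 - reval s e2
  | RMul e1 e2 => reval s e1 * reval s e2
  | RDiv e1 e2 => reval s e1 / reval s e2
  end.

Fixpoint beval (s : store) (b : bexp) : bool :=
  match b with
  | ILt e1 e2 => (ieval s e1 < ieval s e2)%N
  | RLt e1 e2 => reval s e1 < reval s e2
  | BNot b1 => ~~ beval s b1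
  | BAnd b1 b2 => beval s b1 && beval s b2
  end.

(* The commands that remain to be executed, and the memory. *)
Definition config := (seq cmd * store)%type.

(* The equally likely successors of a configuration: none when the run is over,
   e + 1 for IRand (a uniform draw in {0, ..., e}), one otherwise. *)
Definition succs (c : config) : seq config :=
  let s := c.2 in
  if c.1 is p :: k then
    match p with
    | Skip => [:: (k, s)]
    | ISet a i e => [:: (k, iupd s a (ieval s i) (ieval s e))]
    | RSet a i e => [:: (k, rupd s a (ieval s i) (reval s e))]
    | IRand a i e => [seq (k, iupd s a (ieval s i) v) | v <- iota 0 (ieval s e).+1]
    | Seq p1 p2 => [:: (p1 :: p2 :: k, s)]
    | If b p1 p2 => [:: ((if beval s b then p1 else p2) :: k, s)]
    | While b p1 => [:: (if beval s b then p1 :: While b p1 :: k else k, s)]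
    end
  else [::].

(* Every run halts after at most T steps, whatever the random draws.  An
   expression is evaluated in one step; this changes running times only by a
   factor depending on the program, which is fixed before the input. *)
Fixpoint halts_within (T : nat) (c : config) : bool :=
  if nilp c.1 then true else
  if T is T'.+1 then all (halts_within T') (succs c) else false.

(* The probability that a run halts after at most T steps in a memory that
   satisfies E. *)
Fixpoint prob_within (T : nat) (c : config) (E : store -> Prop) : R :=
  if nilp c.1 then (`[< E c.2 >])%:R else
  if T is T'.+1 then
    (\sum_(c' <- succs c) prob_within T' c' E) / (size (succs c))%:R
  else 0.

(* Input: n and t in cells 0 and 1 of integer array 0, abscissas and ordinates
   of the points in real arrays 0 and 1, epsilon in cell 0 of real array 2;
   everything else is zero. *)
Definition input (X : seq (R * R)) (t : nat) (eps : R) : store :=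
  Store (fun a i => if a == 0%N then nth 0%N [:: size X; t] i else 0%N)
        (fun a i => match a with
                    | 0 => (nth (0, 0) X i).1
                    | 1 => (nth (0, 0) X i).2
                    | 2 => nth 0 [:: eps] i
                    | _ => 0
                    end).

Definition init (p : cmd) X t eps : config := ([:: p], input X t eps).

(* Output: the coordinates of a vertex and of the two side vectors, in cells
   0 to 5 of real array 3. *)
Definition output (s : store) : rect R :=
  let o := rmem s 3 in Rect (o 0%N, o 1%N) (o 2%N, o 3%N) (o 4%N, o 5%N).

End Semantics.

(* Main.v *)
Require Import Defs.
From HB Require Import structures.
From mathcomp Require Import all_boot all_order all_algebra.
From mathcomp Require Import boolp classical_sets reals sequences exp.
From mathcomp Require Import zify ring lra.

Set Implicit Arguments.
Unset Strict Implicit.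
Unset Printing Implicit Defensive.

Import Order.TTheory GRing.Theory Num.Theory.

Local Open Scope ring_scope.

(* If eps * n < 16 the program takes S = X and s = n - t.  Otherwise it draws a
   sample S of m = O (p log n / eps^2) points of X with repetition, where
   p = t / n + eps, and takes s = m - k with k about m (t / n + eps / 4).  It
   then returns a smallest box containing s points of S.

   Smallest boxes.  Turn a box until a second point reaches one of its sides, in
   either direction; in between the extremal points do not change and the area
   is a quasi-concave function of the direction, so one of the two turns does
   not increase it.  Hence a smallest box has two points p, q of S on its bottom
   side.  For each of the O (m^2) pairs (p, q) the points are sorted along q - p
   once, and for each top point z one scan over the strip between the bottom and
   z finds the smallest window of s points: O (m^4) steps in all, and m^4 is
   O ((log n / eps^2)^4 p^3).

   Sampling.  All boxes found in this way, for X as well as for S, belong to a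
   family of n^5 boxes given by five points of X.  Chernoff bounds and a union
   bound over this family and over the boxes without their lateral sides show
   that with probability at least 1 - 2 / n a box missing at most t + 2 points of
   X misses at most k points of S, and that a box missing at least
   t + 3 eps n / 8 points of X misses more than k points of S.  As no three points
   of X are collinear, the two lateral sides carry at most four points, which
   gives the upper bound on the number of enclosed points. *)

(** The infimum in [opt] ranges over infinitely many rectangles, while a union bound needs a finite
    family. Candidate boxes bridge this gap twice: a rectangle competing for the optimum of X is
    first replaced by a candidate of X of no larger area, and the box returned is a candidate of S,
    hence in the same family because S consists of points of X. The constants come from three
    equidistant levels of missed fractions: t / n + eps / 8, which covers t + 2 points because eps n
    >= 16; t / n + eps / 4, where k / m is placed; and t / n + 3 eps / 8. Each tail thus has a
    margin of eps / 8, and 3 eps n / 8 stays below eps (n - t) since t < n / 2. A range fails with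
    probability at most n^-6, and there are 2 n^5 of them. The machine has no square root, logarithm
    or rounding. Directions are therefore never normalised, log n is replaced by a binary logarithm
    found by doubling, and m and k are found by counting up. *)

(** * Execution of programs *)

Fixpoint iwrites (p : cmd) : seq nat :=
  match p with
  | ISet a _ _ | IRand a _ _ => [:: a]
  | Seq p q | If _ p q => iwrites p ++ iwrites q
  | While _ p => iwrites p
  | _ => [::]
  end.

Fixpoint rwrites (p : cmd) : seq nat :=
  match p with
  | RSet a _ _ => [:: a]
  | Seq p q | If _ p q => rwrites p ++ rwrites q
  | While _ p => rwrites p
  | _ => [::]
  end.

Fixpoint loop_free (p : cmd) : bool :=
  match p with
  | Skip | ISet _ _ _ | RSet _ _ _ => true
  | Seq p q | If _ p q => loop_free p && loop_free q
  | _ => false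
  end.

Fixpoint cost (p : cmd) : nat :=
  match p with
  | Seq p q | If _ p q => (cost p + cost q).+1
  | _ => 1%N
  end.

Notation ivar a := (IGet a (INum 0)).
Notation rvar a := (RGet a (INum 0)).

(** The bound is evaluated anew at every test, hence the hypothesis in [wp_for] that its value is
    preserved. *)
Definition For (i : nat) (N : iexp) (body : cmd) : cmd :=
  Seq (ISet i (INum 0) (INum 0))
      (While (ILt (ivar i) N)
             (Seq body (ISet i (INum 0) (IAdd (ivar i) (INum 1))))).

Section Logic.
Variable R : realType.
Implicit Types (s : store R) (p : cmd).

(** Big-step semantics of the deterministic part: there is no rule for [IRand]. Step counts agree
    with [succs], where unfolding [Seq], [If] or [While] costs one step. *)
Inductive exec : cmd -> store R -> nat -> store R -> Prop :=
  | exec_skip s : exec Skip s 1 s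
  | exec_iset a i e s :
      exec (ISet a i e) s 1 (iupd s a (ieval s i) (ieval s e))
  | exec_rset a i e s :
      exec (RSet a i e) s 1 (rupd s a (ieval s i) (reval s e))
  | exec_seq p1 p2 s t1 s1 t2 s2 :
      exec p1 s t1 s1 -> exec p2 s1 t2 s2 -> exec (Seq p1 p2) s (t1 + t2).+1 s2
  | exec_if b p1 p2 s t s' :
      exec (if beval s b then p1 else p2) s t s' -> exec (If b p1 p2) s t.+1 s'
  | exec_while_false b p s : ~~ beval s b -> exec (While b p) s 1 s
  | exec_while_true b p s t1 s1 t2 s2 :
      beval s b -> exec p s t1 s1 -> exec (While b p) s1 t2 s2 ->
      exec (While b p) s (t1 + t2).+1 s2.

Lemma exec_imem p s t s' a :
  exec p s t s' -> a \notin iwrites p -> imem s' a = imem s a.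
Proof.
elim=> //=.
- move=> b i e {}s; rewrite inE => /negPf ab.
  by apply/funext => j; rewrite /upd ab.
- move=> p1 p2 {}s t1 s1 t2 s2 _ IH1 _ IH2.
  by rewrite mem_cat negb_or => /andP[n1 n2]; rewrite IH2 // IH1.
- move=> b p1 p2 {}s {}t {}s' _ IH.
  rewrite mem_cat negb_or => /andP[n1 n2].
  by apply: IH; case: ifP.
- by move=> b {}p {}s t1 s1 t2 s2 _ _ IH1 _ IH2 n1; rewrite IH2 // IH1.
Qed.

Lemma exec_rmem p s t s' a :
  exec p s t s' -> a \notin rwrites p -> rmem s' a = rmem s a.
Proof.
elim=> //=.
- move=> b i e {}s; rewrite inE => /negPf ab.
  by apply/funext => j; rewrite /upd ab.
- move=> p1 p2 {}s t1 s1 t2 s2 _ IH1 _ IH2.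
  by rewrite mem_cat negb_or => /andP[n1 n2]; rewrite IH2 // IH1.
- move=> b p1 p2 {}s {}t {}s' _ IH.
  rewrite mem_cat negb_or => /andP[n1 n2].
  by apply: IH; case: ifP.
- by move=> b {}p {}s t1 s1 t2 s2 _ _ IH1 _ IH2 n1; rewrite IH2 // IH1.
Qed.

(** Meaningful on [loop_free] programs only; there the effect is obtained by simplification. Loops
    and draws get the default [s]. *)
Fixpoint run p s : store R :=
  match p with
  | ISet a i e => iupd s a (ieval s i) (ieval s e)
  | RSet a i e => rupd s a (ieval s i) (reval s e)
  | Seq p1 p2 => run p2 (run p1 s)
  | If b p1 p2 => if beval s b then run p1 s else run p2 s
  | _ => s
  end.

Lemma exec_run p s :
  loop_free p -> exists2 t, (t <= cost p)%N & exec p s t (run p s).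
Proof.
elim: p s => //=.
- by move=> s _; exists 1%N => //; constructor.
- by move=> a i e s _; exists 1%N => //; constructor.
- by move=> a i e s _; exists 1%N => //; constructor.
- move=> p1 IH1 p2 IH2 s /andP[/(IH1 s)[t1 l1 e1] /(IH2 (run p1 s))[t2 l2 e2]].
  by exists (t1 + t2).+1; [lia | apply: exec_seq e1 e2].
- move=> b p1 IH1 p2 IH2 s /andP[/(IH1 s)[t1 l1 e1] /(IH2 s)[t2 l2 e2]].
  case: (boolP (beval s b)) => eb.
    by exists t1.+1; [lia | apply: exec_if; rewrite eb].
  by exists t2.+1; [lia | apply: exec_if; rewrite (negPf eb)].
Qed.

(** The frame condition. It is read off the syntax array by array, so carrying untouched data across
    a command costs only a side condition solved by computation. *)
Definition same p s s' :=
  (forall a, a \notin iwrites p -> imem s' a = imem s a) /\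
  (forall a, a \notin rwrites p -> rmem s' a = rmem s a).

Lemma same_trans p s1 s2 s3 : same p s1 s2 -> same p s2 s3 -> same p s1 s3.
Proof. by move=> [i1 r1] [i2 r2]; split=> a na; rewrite ?i2 ?i1 ?r2 ?r1. Qed.

Lemma exec_same p s t s' : exec p s t s' -> same p s s'.
Proof. by move=> e; split=> a; [apply: exec_imem e | apply: exec_rmem e]. Qed.

Definition wp p T (Q : store R -> Prop) s :=
  exists t s', [/\ (t <= T)%N, exec p s t s' & Q s'].

Lemma wp_weaken p T T' (Q Q' : store R -> Prop) s :
  wp p T Q s -> (T <= T')%N ->
  (forall s', Q s' -> same p s s' -> Q' s') -> wp p T' Q' s.
Proof.
move=> [t [s' [lt e q]]] lT QQ'; exists t, s'; split=> //; first by lia.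
by apply: QQ' => //; apply: exec_same e.
Qed.

Lemma wp_run p (Q : store R -> Prop) s T :
  loop_free p -> (cost p <= T)%N -> Q (run p s) -> wp p T Q s.
Proof.
move=> lf lT q; have [t lt e] := exec_run s lf.
by exists t, (run p s); split=> //; apply: leq_trans lT.
Qed.

Lemma wp_seq p1 p2 T1 T2 (Q1 Q : store R -> Prop) s :
  wp p1 T1 Q1 s ->
  (forall s1, same p1 s s1 -> Q1 s1 -> wp p2 T2 Q s1) ->
  wp (Seq p1 p2) (T1 + T2).+1 Q s.
Proof.
move=> [t1 [s1 [l1 e1 q1]]] H2.
have [t2 [s2 [l2 e2 q2]]] := H2 s1 (exec_same e1) q1.
by exists (t1 + t2).+1, s2; split=> //; [lia | apply: exec_seq e1 e2].
Qed.

Lemma wp_if b p1 p2 T (Q : store R -> Prop) s :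
  (beval s b -> wp p1 T Q s) -> (~~ beval s b -> wp p2 T Q s) ->
  wp (If b p1 p2) T.+1 Q s.
Proof.
move=> H1 H2; case: (boolP (beval s b)) => eb.
  have [t [s' [lt e q]]] := H1 eb; exists t.+1, s'; split=> //.
  by apply: exec_if; rewrite eb.
have [t [s' [lt e q]]] := H2 eb; exists t.+1, s'; split=> //.
by apply: exec_if; rewrite (negPf eb).
Qed.

(** The index of the invariant counts iterations. That [j < N] must follow from the guard gives
    termination and the time bound together. *)
Lemma wp_while b p T N (I : nat -> store R -> Prop) s :
  I 0%N s ->
  (forall j s', same p s s' -> I j s' -> beval s' b ->
    (j < N)%N /\ wp p T (I j.+1) s') ->
  wp (While b p) (N * T.+1).+1
     (fun s' => ~~ beval s' b /\ exists2 j, (j <= N)%N & I j s') s.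
Proof.
move=> I0 step.
suff H j d s' : (j + d = N)%N -> same p s s' -> I j s' ->
    wp (While b p) (d * T.+1).+1
     (fun s' => ~~ beval s' b /\ exists2 j, (j <= N)%N & I j s') s'.
  by apply: (H 0%N N).
elim: d j s' => [|d IH] j s' jd ss Ij; case: (boolP (beval s' b)) => eb.
- by have [] := step _ _ ss Ij eb; lia.
- exists 1%N, s'; split=> //; first exact: exec_while_false.
  by split=> //; exists j => //; lia.
- have [_ [t1 [s1 [l1 e1 I1]]]] := step _ _ ss Ij eb.
  have [||t2 [s2 [l2 e2 I2]]] := IH j.+1 s1 _ _ I1; first by lia.
    exact: same_trans ss (exec_same e1).
  exists (t1 + t2).+1, s2; split=> //; last exact: exec_while_true e1 e2.
  by rewrite mulSn; lia.
- exists 1%N, s'; split=> //; first exact: exec_while_false.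
  by split=> //; exists j => //; lia.
Qed.

(** The counter is written outside the body, so the invariant has to survive a change of its cell;
    the body receives the current value as a separate hypothesis. *)
Lemma wp_for i e body T N (I : nat -> store R -> Prop) s :
  i \notin iwrites body ->
  (forall s', same (For i e body) s s' -> ieval s' e = N) ->
  (forall j s' v, I j s' -> I j (iupd s' i 0 v)) ->
  I 0%N s ->
  (forall j s', (j < N)%N -> same (For i e body) s s' -> imem s' i 0 = j ->
     I j s' -> wp body T (I j.+1) s') ->
  wp (For i e body) (N * (T + 3) + 3) (I N) s.
Proof.
move=> niw eN stab I0 step.
pose J j s' := [/\ (j <= N)%N, imem s' i 0 = j, I j s' & same (For i e body) s s'].
have sub s1 s2 : same (Seq body (ISet i (INum 0) (IAdd (ivar i) (INum 1)))) s1 s2 ->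
    same (For i e body) s1 s2.
  by move=> [h1 h2]; split=> a; rewrite ?inE /= ?negb_or ?inE => na;
    [apply: h1; case/andP: na | apply: h2].
apply: (@wp_weaken _ (1 + (N * (T + 2).+1).+1).+1 _
  (fun s' => ~~ beval s' (ILt (ivar i) e) /\ exists2 j, (j <= N)%N & J j s')).
- apply: (@wp_seq _ _ _ _ (J 0%N)).
    apply: wp_run => //=; split=> //=; first by rewrite /upd /= eqxx.
      exact: stab.
    split=> a //=; rewrite inE negb_or => /andP[/negPf na _].
    by apply/funext => k; rewrite /upd na.
  move=> s1 ss1 J0; apply: wp_while => // j s2 ss2 [jN ij Ij ss] /= lt.
  rewrite eN // ij in lt; split=> //.
  apply: (@wp_weaken _ (T + 1).+1) => //; first last.
    by move=> s3 h _; exact: h.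
    by lia.
  apply: wp_seq; first exact: (step j).
  move=> s3 ss3 I3; apply: wp_run => //=.
  have e3 : imem s3 i 0 = j by rewrite ss3.1.
  split=> //=.
  + by rewrite /upd !eqxx /= e3 addn1.
  + exact: stab.
  + apply: (same_trans ss); apply: sub; split=> a /=; rewrite mem_cat negb_or => /andP[n1].
      rewrite inE => /negPf n2; rewrite -ss3.1 //.
      by apply/funext => k; rewrite /upd n2.
    by move=> _; rewrite -ss3.2.
- by nia.
- move=> s' [/= nb [j jN [_ ij Ij ss]]] _.
  rewrite (eN _ ss) ij -leqNgt in nb.
  by have <- : j = N by lia.
Qed.

(** Both conjuncts are recursions over the same tree of runs: halting is required on every branch,
    success is averaged over the branches. *)
Definition ok T (c : config R) E (pi : R) :=
  halts_within T c /\ pi <= prob_within T c E.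

Lemma halts_withinS T p k s :
  halts_within T.+1 (p :: k, s) = all (halts_within T) (succs (p :: k, s)).
Proof. by []. Qed.

Lemma prob_withinS T p k s E :
  prob_within T.+1 (p :: k, s) E =
  (\sum_(c <- succs (p :: k, s)) prob_within T c E) / (size (succs (p :: k, s)))%:R.
Proof. by []. Qed.

Lemma prob_within_ge0 T (c : config R) E : 0 <= prob_within T c E.
Proof.
elim: T c => [|T IH] [[|p k] s]; rewrite ?prob_withinS /= ?ler0n //.
by rewrite divr_ge0 ?ler0n ?sumr_ge0.
Qed.

Lemma ok_leq T T' c E pi : ok T c E pi -> (T <= T')%N -> ok T' c E pi.
Proof.
move=> + /subnK <-; elim: (T' - T)%N => // d IH /IH {IH}.
rewrite addSn; move: (d + T)%N => {T'} {}T [h l]; split.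
  elim: T c h {l} => [|T IH] [[|p k] s] //.
  by rewrite (halts_withinS T.+1) halts_withinS; apply: sub_all => c'; exact: IH.
apply: le_trans l _ => {h}.
elim: T c => [|T IH] [[|p k] s] //.
  exact: prob_within_ge0.
rewrite (prob_withinS T.+1) prob_withinS.
by rewrite ler_wpM2r ?invr_ge0 ?ler0n // ler_sum.
Qed.

Lemma ok_step T p k s c' E pi :
  succs (p :: k, s) = [:: c'] -> ok T c' E pi -> ok T.+1 (p :: k, s) E pi.
Proof.
by move=> e [h l]; rewrite /ok halts_withinS prob_withinS e /= h big_seq1 divr1.
Qed.

(** A deterministic prefix has a single successor at each step, so it adds to the time and leaves
    the probability alone. *)
Lemma exec_ok p s t s' k N E pi :
  exec p s t s' -> ok N (k, s') E pi -> ok (t + N) (p :: k, s) E pi.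
Proof.
move=> e; elim: e k N => {p s t s'}.
- by move=> s k N h; apply: ok_step h.
- by move=> a i e s k N h; apply: ok_step h.
- by move=> a i e s k N h; apply: ok_step h.
- move=> p1 p2 s t1 s1 t2 s2 _ IH1 _ IH2 k N h.
  rewrite addSn -addnA; apply: (@ok_step _ _ _ _ (p1 :: p2 :: k, s)) => //.
  by apply: IH1; apply: IH2.
- by move=> b p1 p2 s t s' _ IH k N /IH h; apply: ok_step h.
- move=> b p s nb k N h; apply: (@ok_step _ _ _ _ (k, s)) h.
  by rewrite /succs /= (negPf nb).
- move=> b p s t1 s1 t2 s2 eb _ IH1 _ IH2 k N h.
  rewrite addSn -addnA.
  apply: (@ok_step _ _ _ _ (p :: While b p :: k, s)); first by rewrite /succs /= eb.
  by apply: IH1; apply: IH2.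
Qed.

Lemma wp_ok p T (Q : store R -> Prop) s k N E pi :
  wp p T Q s -> (forall s', same p s s' -> Q s' -> ok N (k, s') E pi) ->
  ok (T + N) (p :: k, s) E pi.
Proof.
move=> [t [s' [lt e q]]] h.
apply: ok_leq (exec_ok e (h _ (exec_same e) q)) _.
by rewrite leq_add2r.
Qed.

Lemma ok_seq T p1 p2 k s E pi :
  ok T (p1 :: p2 :: k, s) E pi -> ok T.+1 (Seq p1 p2 :: k, s) E pi.
Proof. exact: ok_step. Qed.

Lemma ok_if T b p1 p2 k s (E : store R -> Prop) pi :
  ok T ((if beval s b then p1 else p2) :: k, s) E pi ->
  ok T.+1 (If b p1 p2 :: k, s) E pi.
Proof. exact: ok_step. Qed.

(** The bound [pi] may depend on the value drawn. Averaging it is what later produces one level of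
    [avg] per draw. *)
Lemma ok_rand T a i e k s E (pi : nat -> R) :
  (forall v, (v <= ieval s e)%N -> ok T (k, iupd s a (ieval s i) v) E (pi v)) ->
  ok T.+1 (IRand a i e :: k, s) E
     ((\sum_(0 <= v < (ieval s e).+1) pi v) / (ieval s e).+1%:R).
Proof.
move=> h; rewrite /ok halts_withinS prob_withinS.
have -> : succs (IRand a i e :: k, s) =
   [seq (k, iupd s a (ieval s i) v) | v <- iota 0 (ieval s e).+1] by [].
split.
  rewrite all_map; apply/allP => v; rewrite mem_iota => /andP[_ lv].
  exact: (h v _).1.
rewrite size_map size_iota ler_wpM2r ?invr_ge0 ?ler0n //.
rewrite big_map /index_iota subn0 big_seq [in leRHS]big_seq ler_sum // => v.
by rewrite mem_iota => /andP[_ lv]; apply: (h v _).2.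
Qed.

End Logic.

(** * Windows in a sorted list *)

Lemma sub_in_count (T : eqType) (P Q : pred T) (s : seq T) :
  {in s, forall x, P x -> Q x} -> (count P s <= count Q s)%N.
Proof.
move=> PQ; rewrite (@eq_in_count _ P (predI P Q)).
  by apply: sub_count => x /andP[].
by move=> x /PQ h /=; case: (P x) h => // ->.
Qed.

Lemma count_nth_iota (T : Type) (x0 : T) (P : pred T) (B : seq T) :
  count P B = count (fun k => P (nth x0 B k)) (iota 0 (size B)).
Proof. by rewrite -[in LHS](mkseq_nth x0 B) /mkseq count_map. Qed.

Lemma count_interval_iota (i l N : nat) :
  (i + l <= N)%N -> count (fun k => (i <= k < i + l)%N) (iota 0 N) = l.
Proof.
move=> le.
have -> : N = (i + (l + (N - i - l)))%N by lia.
rewrite iotaD iotaD !count_cat add0n.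
rewrite (@eq_in_count _ _ pred0); last by move=> k; rewrite mem_iota /=; lia.
rewrite (@eq_in_count _ _ predT (iota i l)); last by move=> k; rewrite mem_iota /=; lia.
rewrite (@eq_in_count _ _ pred0 (iota (i + l) _)); last by move=> k; rewrite mem_iota /=; lia.
by rewrite !count_pred0 count_predT size_iota addn0.
Qed.

Lemma count_interval_iota_le (i l N : nat) :
  (count (fun k => (i <= k < i + l)%N) (iota 0 N) <= l)%N.
Proof.
have := @count_interval_iota i l (maxn N (i + l)) (leq_maxr _ _).
rewrite {1}(_ : maxn N (i + l) = N + (maxn N (i + l) - N))%N; last by lia.
by rewrite iotaD count_cat => e; rewrite -[leqRHS]e leq_addr.
Qed.

Section Windows.
Variable R : realType.
Implicit Types (B : seq R) (a b : R) (s i : nat).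

(** The negations mirror the test in [windows_prog]: at least [s] keys remain from [i] on, and [i]
    is the first occurrence of its key, so no equal key precedes the window. *)
Definition win_start s B i : bool :=
  (~~ (size B < i + s)%N) && ~~ ((0 < i)%N && ~~ (B`_i.-1 < B`_i)).

Definition win_end s B i : nat :=
  let j := (i + s - 1)%N in
  if (j.+1 < size B)%N && ~~ (B`_j < B`_j.+1) then j.+1 else j.

Definition windows s B : seq (R * R) :=
  [seq (B`_i, B`_(win_end s B i)) | i <- iota 0 (size B) & win_start s B i].

Definition closed_count a b B := count (fun x => a <= x <= b) B.
Definition open_count a b B := count (fun x => a < x < b) B.

Lemma sorted_nth_le B i j :
  sorted <=%R B -> (i <= j < size B)%N -> B`_i <= B`_j.
Proof.
move=> sB /andP[ij jl]; apply: (sorted_leq_nth le_trans le_refl) => //.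
by rewrite inE; apply: leq_ltn_trans jl.
Qed.

Lemma sorted_nth_lt B i j :
  sorted <=%R B -> (i < size B)%N -> B`_i < B`_j -> (i < j)%N.
Proof.
move=> sB il; rewrite ltnNge; apply: contraTN => ji.
by rewrite -leNgt sorted_nth_le ?ji.
Qed.

Lemma windowsP s B a b : (0 < s)%N -> (a, b) \in windows s B ->
  exists i j, [/\ (i + s <= size B)%N, (i + s - 1 <= j <= i + s)%N,
    (j < size B)%N, (a, b) = (B`_i, B`_j) &
    [/\ j = (i + s)%N -> ~~ (B`_(i + s - 1) < B`_(i + s)), 
       (0 < i)%N -> B`_i.-1 < B`_i &
       j = (i + s - 1)%N -> (j.+1 < size B)%N -> B`_j < B`_j.+1]].
Proof.
move=> s0 /mapP[i]; rewrite mem_filter => /andP[/andP[st h] _] [-> ->].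
exists i, (win_end s B i); rewrite /win_end; set j := (i + s - 1)%N.
have hi : (0 < i)%N -> B`_i.-1 < B`_i.
  by move=> i0; move: h; rewrite i0 /= negbK.
have ej : (i + s)%N = j.+1 by lia.
case: ifP => [/andP[lt nl]|h']; split=> //; try lia.
- by split=> //; [rewrite ej | lia].
- split=> //; first by lia.
  by move=> _ lt; move: h'; rewrite lt /= => /negbFE.
Qed.

Lemma windows_le s B a b :
  (0 < s)%N -> sorted <=%R B -> (a, b) \in windows s B -> a <= b.
Proof.
move=> s0 sB /(windowsP s0)[i [j [h1 h2 h3 [-> ->] _]]].
by apply: sorted_nth_le => //; lia.
Qed.

Lemma windows_mem s B a b :
  (0 < s)%N -> (a, b) \in windows s B -> a \in B /\ b \in B.
Proof.
move=> s0 /(windowsP s0)[i [j [h1 h2 h3 [-> ->] _]]].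
have il : (i < size B)%N by lia.
by split; apply: mem_nth.
Qed.

Lemma windows_closed_count s B a b :
  (0 < s)%N -> sorted <=%R B -> (a, b) \in windows s B ->
  (s <= closed_count a b B)%N.
Proof.
move=> s0 sB /(windowsP s0)[i [j [h1 h2 h3 [-> ->] _]]].
rewrite /closed_count (count_nth_iota 0) -{1}(count_interval_iota h1).
rewrite -!size_filter !size_filter; apply: sub_in_count => k.
rewrite mem_iota => kl /andP[ik ki]; have kB : (k < size B)%N := kl.
by apply/andP; split; apply: sorted_nth_le => //; lia.
Qed.

(** Keys strictly between the ends have indices strictly between [i] and [j <= i + s], which leaves
    at most [s - 1]. Unlike the bound on the closed count, this holds with repeated keys, as needed
    for a sample with repetitions. *)
Lemma windows_open_count s B a b :
  (0 < s)%N -> sorted <=%R B -> (a, b) \in windows s B ->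
  (open_count a b B < s)%N.
Proof.
move=> s0 sB /(windowsP s0)[i [j [h1 h2 h3 [-> ->] _]]].
rewrite /open_count (count_nth_iota 0) -(ltn_predK s0) ltnS.
apply: leq_trans (count_interval_iota_le i.+1 s.-1 (size B)).
apply: sub_in_count => k; rewrite mem_iota => kl /andP[ik kj]; have kB : (k < size B)%N := kl.
have il : (i < size B)%N by lia.
have := sorted_nth_lt sB il ik; have := sorted_nth_lt sB kB kj; lia.
Qed.

(* Ties are absorbed: a window either ends strictly before the next key, or was
   lengthened by one to include a tie, and no key occurs three times. *)
Lemma windows_closed_count_le s B a b :
  (0 < s)%N -> sorted <=%R B -> (forall x, (count_mem x B <= 2)%N) ->
  (a, b) \in windows s B -> (closed_count a b B <= s.+1)%N.
Proof.
move=> s0 sB mult /(windowsP s0)[i [j [h1 h2 h3 [-> ->] [tie hi hj]]]].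
rewrite /closed_count (count_nth_iota 0).
apply: leq_trans (count_interval_iota_le i s.+1 (size B)).
apply: sub_in_count => k; rewrite mem_iota => kl /andP[ik kj]; have kB : (k < size B)%N := kl.
have le1 : (i <= k)%N.
  case: (posnP i) => [->//|i0].
  have il : (i.-1 < size B)%N by lia.
  by have := sorted_nth_lt sB il (lt_le_trans (hi i0) ik); lia.
rewrite le1 /= addnS ltnS leqNgt; apply/negP => lk.
case: (ltnP j (i + s)) => ji.
  have ej : j = (i + s - 1)%N by lia.
  have jl : (j.+1 < size B)%N by lia.
  have := hj ej jl; apply/negP; rewrite -leNgt; apply: le_trans kj.
  by apply: sorted_nth_le => //; lia.
have ej : j = (i + s)%N by lia.
have eB l : (i + s - 1 <= l <= k)%N -> B`_l = B`_j.
  move=> hl; apply/eqP; rewrite eq_le; apply/andP; split.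
    by apply: le_trans kj; apply: sorted_nth_le => //; lia.
  have := tie ej; rewrite -leNgt -ej => /le_trans; apply.
  by apply: sorted_nth_le => //; lia.
have := mult B`_j; rewrite leqNgt (count_nth_iota 0) => /negP; apply.
have h4 : ((i + s - 1) + 3 <= size B)%N by lia.
rewrite -(count_interval_iota h4); apply: sub_in_count => l _ hl.
by rewrite /= eB //; lia.
Qed.

(** The window starts at the first key [>= a]. All keys in [[a, b]] lie from there on and there are
    at least [s] of them, so the [s]-th one does not exceed [b]. *)
Lemma windows_minimal s B a b :
  (0 < s)%N -> sorted <=%R B -> (s <= closed_count a b B)%N ->
  exists a' b', [/\ (a', b') \in windows s B, a <= a' & b' <= b].
Proof.
move=> s0 sB cnt; set P := (fun x => a <= x).
have fl : (find P B < size B)%N.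
  rewrite -has_find has_count; apply: leq_trans s0 (leq_trans cnt _).
  by apply: sub_count => x /andP[].
set i := find P B.
have ai : a <= B`_i by apply: nth_find; rewrite has_find.
have ib k : (k < i)%N -> B`_k < a.
  by move=> ki; have := before_find 0 ki; rewrite /P => /negbT; rewrite -ltNge.
(* If the keys [<= b] ended after [l < s] keys from [i] on, the interval would hold at most [l]
   keys. *)
have key l : (i + l <= size B)%N -> (l < s)%N -> ~~ ((i + l < size B)%N && (B`_(i + l) <= b)) -> False.
  move=> h1 h2 h3; move: cnt; apply/negP; rewrite -ltnNge.
  apply: leq_ltn_trans h2; apply: leq_trans (count_interval_iota_le i l (size B)).
  rewrite /closed_count (count_nth_iota 0); apply: sub_in_count => k.
  rewrite mem_iota => kl /andP[ak kb]; have kB : (k < size B)%N := kl; apply/andP; split.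
    by rewrite leqNgt; apply/negP => /ib; rewrite ltNge ak.
  rewrite ltnNge; apply/negP => lk; move/negP: h3; apply.
  apply/andP; split; first by lia.
  by apply: le_trans kb; apply: sorted_nth_le => //; lia.
have isB : (i + s <= size B)%N.
  rewrite leqNgt; apply/negP => h.
  by apply: (key (size B - i)%N); lia.
have eb : B`_(i + s - 1) <= b.
  rewrite -addnBA //; case: (boolP (_ <= b)) => // nb.
  by case: (key (s - 1)%N); [lia|lia|rewrite (negPf nb) andbF].
exists B`_i, B`_(win_end s B i); split=> //.
  apply/mapP; exists i => //; rewrite mem_filter mem_iota /= fl andbT.
  rewrite /win_start -leqNgt isB /= negb_and negbK -leqNgt leqn0.
  case: (posnP i) => //= i0; apply: lt_le_trans ai; apply: ib; lia.
rewrite /win_end; case: ifP => // /andP[_]; rewrite -leNgt => h.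
exact: le_trans eb.
Qed.

End Windows.

(** * Boxes of minimal area *)

Section Flush.
Variable R : realType.
Implicit Types (u w d x y z : R * R) (P : seq (R * R)).

Definition dot u x : R := u.1 * x.1 + u.2 * x.2.
Definition crs u x : R := u.1 * x.2 - u.2 * x.1.
Definition vsub x y : R * R := (x.1 - y.1, x.2 - y.2).
Definition turn90 u : R * R := (- u.2, u.1).

Lemma dot_gt0 u : (0 < dot u u) = (u != (0, 0)).
Proof.
case: u => a b; rewrite /dot /= xpair_eqE negb_and.
rewrite lt0r paddr_eq0 -?expr2 ?sqr_ge0 // !sqrf_eq0 negb_and.
by rewrite addr_ge0 ?sqr_ge0 // andbT.
Qed.

Lemma dotZ (mu : R) w x : dot (mu * w.1, mu * w.2) x = mu * dot w x.
Proof. by rewrite /dot /=; ring. Qed.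

Lemma crsZ (mu : R) w x : crs (mu * w.1, mu * w.2) x = mu * crs w x.
Proof. by rewrite /crs /=; ring. Qed.

Lemma exists_argmin (T : eqType) (f : T -> R) (s : seq T) : s != [::] ->
  exists2 a, a \in s & forall b, b \in s -> f a <= f b.
Proof.
elim: s => // y [|z s] IH _.
  by exists y; rewrite ?mem_head // => x; rewrite inE => /eqP ->.
have [//|a aP amin] := IH; case: (leP (f a) (f y)) => h.
  exists a; first by rewrite inE aP orbT.
  by move=> x; rewrite inE => /predU1P[->//|/amin].
exists y; rewrite ?mem_head // => x; rewrite inE => /predU1P[->//|/amin].
exact: le_trans (ltW h).
Qed.

Definition extremal P w a b c e :=
  [/\ [/\ a \in P, b \in P, c \in P & e \in P],
      forall x, x \in P -> dot w a <= dot w x <= dot w b &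
      forall x, x \in P -> crs w c <= crs w x <= crs w e].

(** The direction is not a unit vector: each extent carries a factor [|w|], whence the division by
    [dot w w]. *)
Definition extent_area w a b c e :=
  (dot w b - dot w a) * (crs w e - crs w c) / dot w w.

(** Quarter turns permute the four sides cyclically, so a second point on any side can be treated as
    one on the bottom side. *)
Lemma extremal_turn90 P w a b c e :
  extremal P w a b c e -> extremal P (turn90 w) c e b a.
Proof.
move=> [[? ? ? ?] h1 h2]; split=> // x xP; have := h1 x xP; have := h2 x xP;
  rewrite /dot /crs /turn90 /= => /andP[? ?] /andP[? ?]; apply/andP; split; lra.
Qed.

Lemma extent_area_turn90 w a b c e :
  extent_area (turn90 w) c e b a = extent_area w a b c e.
Proof.
rewrite /extent_area; congr (_ / _); rewrite /dot /crs /turn90 /=; ring.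
Qed.

(** The bottom point is [p] and the direction is [q - p], so [q] lies on the bottom side too. This
    is the shape enumerated by [cands3]. *)
Definition flush_area P (A : R) :=
  exists p q r a b, [/\ p != q, q \in P, extremal P (vsub q p) a b p r &
                        extent_area (vsub q p) a b p r <= A].

(** Rescaling a direction by a positive factor changes neither the extremal points nor the area. *)
Lemma extremal_pair P w a b p q r (mu : R) :
  0 < mu -> vsub q p = (mu * w.1, mu * w.2) -> extremal P w a b p r ->
  p != q -> q \in P -> w != (0, 0) -> flush_area P (extent_area w a b p r).
Proof.
move=> mu0 e [mems h1 h2] pq qP w0; exists p, q, r, a, b; rewrite e; split=> //.
  split=> // x xP; rewrite ?dotZ ?crsZ !ler_pM2l //; [exact: h1 | exact: h2].
rewrite -dot_gt0 in w0; rewrite le_eqVlt; apply/orP; left; apply/eqP.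
have mu1 : mu != 0 by rewrite gt_eqF.
have w1 : dot w w != 0 by rewrite gt_eqF.
rewrite /extent_area !dotZ !crsZ.
have -> : dot w (mu * w.1, mu * w.2) = mu * dot w w by rewrite /dot /=; ring.
by field; rewrite mu1 w1.
Qed.

Lemma extremal_bottom_tie P w a b c e x :
  w != (0, 0) -> extremal P w a b c e -> x \in P -> x != c ->
  crs w x = crs w c -> flush_area P (extent_area w a b c e).
Proof.
move=> w0 ext xP xc tie; have := w0; rewrite -dot_gt0 => w1.
have w2 : dot w w != 0 by rewrite gt_eqF.
set mu := dot w (vsub x c) / dot w w.
have e1 : vsub x c = (mu * w.1, mu * w.2).
  have t0 : crs w (vsub x c) = 0.
    by move: tie; rewrite /crs /vsub /= => tie; lra.
  (* For [v = x - c], [|w|^2 v = (dot w v) w + (crs w v) (turn90 w)], and the second term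
     vanishes. *)
  apply/eqP; rewrite /mu xpair_eqE; apply/andP; split; apply/eqP;
    apply: (mulIf w2); rewrite mulrAC divfK //.
    by rewrite -[LHS]addr0 -(mulr0 (w.2)) -t0 /dot /crs /vsub /=; ring.
  by rewrite -[LHS]subr0 -(mulr0 (w.1)) -t0 /dot /crs /vsub /=; ring.
have [mu0|mu0|mu0] := ltgtP 0 mu.
- by apply: extremal_pair mu0 e1 ext _ xP w0; rewrite eq_sym.
(* When [x] lies behind [c] the two exchange roles, so that the new direction is a positive multiple
   of [w]. *)
- have ext' : extremal P w a b x e.
    by case: ext => [[? ? ? ?] ? ?]; split=> //; rewrite tie.
  have -> : extent_area w a b c e = extent_area w a b x e by rewrite /extent_area tie.
  apply: (@extremal_pair _ _ _ _ x c e (- mu)) => //; first by rewrite oppr_gt0.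
    by case: e1; rewrite /vsub => e1 e2; congr pair; lra.
  by case: ext => -[].
- case/negP: xc; case: e1; rewrite -mu0 !mul0r => /subr0_eq e1 /subr0_eq e2.
  by case: x e1 e2 {xP tie mu mu0} => ? ? /= -> ->; case: c {ext}.
Qed.

Lemma extremal_tie P w a b c e x :
  w != (0, 0) -> extremal P w a b c e -> x \in P ->
  [\/ x != a /\ dot w x = dot w a, x != b /\ dot w x = dot w b,
      x != c /\ crs w x = crs w c | x != e /\ crs w x = crs w e] ->
  flush_area P (extent_area w a b c e).
Proof.
have t0 u : u != (0, 0) -> turn90 u != (0, 0).
  case: u => u1 u2; rewrite /turn90 !xpair_eqE !negb_and oppr_eq0 /=.
  by rewrite orbC.
have d90 u y : dot (turn90 u) y = crs u y by rewrite /dot /crs /turn90 /=; ring.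
have c90 u y : crs (turn90 u) y = - dot u y by rewrite /dot /crs /turn90 /=; ring.
move=> w0 ext xP tie.
have ext1 := extremal_turn90 ext; have ext2 := extremal_turn90 ext1.
have ext3 := extremal_turn90 ext2.
have E1 := extent_area_turn90 w a b c e.
have E2 := extent_area_turn90 (turn90 w) c e b a.
have E3 := extent_area_turn90 (turn90 (turn90 w)) b a e c.
case: tie => -[nx tx].
- rewrite -E1 -E2 -E3; apply: (extremal_bottom_tie _ ext3 xP) => //; rewrite ?t0 //.
  by rewrite !(c90, d90) tx.
- rewrite -E1; apply: (extremal_bottom_tie _ ext1 xP) => //; rewrite ?t0 //.
  by rewrite !(c90, d90) tx.
- exact: (extremal_bottom_tie _ ext xP).
- rewrite -E1 -E2; apply: (extremal_bottom_tie _ ext2 xP) => //; rewrite ?t0 //.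
  by rewrite !(c90, d90) tx.
Qed.

(** The affine functions [f i + tau * g i] start positive; the first to vanish is the decreasing one
    with least ratio [f i / - g i]. *)
Lemma first_zero (T : eqType) (G : seq T) (f g : T -> R) :
  (forall i, i \in G -> 0 < f i) -> (exists2 i, i \in G & g i < 0) ->
  exists tau, [/\ 0 < tau, forall i, i \in G -> 0 <= f i + tau * g i &
     exists2 i, i \in G & f i + tau * g i = 0].
Proof.
move=> f0 [x0 x0G gx0]; pose H := [seq i <- G | g i < 0].
have x0H : x0 \in H by rewrite mem_filter gx0.
have H0 : H != [::] by case: (H) x0H.
have [y yH ymin] := exists_argmin (fun i => f i / - g i) H0.
move: (yH); rewrite mem_filter => /andP[gy yG].
have t0 : 0 < f y / - g y by rewrite divr_gt0 ?f0 ?oppr_gt0.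
exists (f y / - g y); split=> //.
  move=> x xG; have [gx|gx] := leP 0 (g x).
    by apply: addr_ge0 (ltW (f0 _ xG)) (mulr_ge0 (ltW t0) gx).
  have := ymin x; rewrite mem_filter gx xG => /(_ isT).
  rewrite ler_pdivlMr ?oppr_gt0 //; lra.
by exists y => //; field; rewrite lt_eqF.
Qed.

(* A and B are the side lengths in direction u; turning u by the angle with
   tangent tau changes them to A + tau A' and B + tau B', up to the factor
   sqrt (1 + tau ^ 2). *)
Lemma area_quasi_concave (A A' B B' N t0 t1 : R) :
  0 < N -> 0 < t0 -> 0 < t1 -> 0 <= A -> 0 <= B ->
  0 <= A + t0 * A' -> 0 <= B + t0 * B' -> 0 <= A - t1 * A' -> 0 <= B - t1 * B' ->
  (A + t0 * A') * (B + t0 * B') / (N * (1 + t0 ^+ 2)) <= A * B / N \/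
  (A - t1 * A') * (B - t1 * B') / (N * (1 + t1 ^+ 2)) <= A * B / N.
Proof.
move=> N0 t00 t10 A0 B0 h1 h2 h3 h4.
have c0 : 0 < 1 + t0 ^+ 2 by rewrite addr_gt0 ?exprn_gt0.
have c1 : 0 < 1 + t1 ^+ 2 by rewrite addr_gt0 ?exprn_gt0.
rewrite !ler_pdivrMr ?mulr_gt0 //.
have -> : A * B / N * (N * (1 + t0 ^+ 2)) = A * B * (1 + t0 ^+ 2) by field; rewrite gt_eqF.
have -> : A * B / N * (N * (1 + t1 ^+ 2)) = A * B * (1 + t1 ^+ 2) by field; rewrite gt_eqF.
case: leP => k1; first by left.
case: leP => k2; first by right.
(* If both turns increased the area, adding the two inequalities would give [A B < A' B'], so [A']
   and [B'] have the same sign. In the turn where both sides shrink, their nonnegativity makes the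
   first-order loss [|K|] at least twice the second-order gain, a contradiction. *)
exfalso; pose K := A' * B + A * B'.
have k1' : t0 * (A * B) < K + t0 * (A' * B').
  rewrite -(ltr_pM2l t00) -(ltrD2l (A * B)); rewrite /K; nra.
have k2' : t1 * (A * B) < - K + t1 * (A' * B').
  rewrite -(ltr_pM2l t10) -(ltrD2l (A * B)); rewrite /K; nra.
have AB : 0 <= A * B by rewrite mulr_ge0.
have AB' : 0 < A' * B'.
  have : (t0 + t1) * (A * B) < (t0 + t1) * (A' * B') by lra.
  by rewrite ltr_pM2l ?addr_gt0 //; apply: le_lt_trans.
case: (ltgtP 0 A') => a0.
- have b0 : 0 < B' by rewrite pmulr_rgt0 in AB'.
  have : 2 * (t1 * (A' * B')) <= K by rewrite /K; nra.
  have : 0 <= t1 * (A * B) by rewrite mulr_ge0 // ltW.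
  have : 0 < t1 * (A' * B') by rewrite mulr_gt0.
  by lra.
- have b0 : B' < 0 by rewrite nmulr_rgt0 in AB'.
  have : K <= - (2 * (t0 * (A' * B'))) by rewrite /K; nra.
  have : 0 <= t0 * (A * B) by rewrite mulr_ge0 // ltW.
  have : 0 < t0 * (A' * B') by rewrite mulr_gt0.
  by lra.
- by move: AB'; rewrite -a0 mul0r ltxx.
Qed.

Definition tilt u (tau : R) : R * R := (u.1 - tau * u.2, u.2 + tau * u.1).

Lemma dot_tilt u tau x : dot (tilt u tau) x = dot u x + tau * crs u x.
Proof. by rewrite /dot /crs /tilt /=; ring. Qed.

Lemma crs_tilt u tau x : crs (tilt u tau) x = crs u x - tau * dot u x.
Proof. by rewrite /dot /crs /tilt /=; ring. Qed.

Lemma tilt_neq0 u tau : u != (0, 0) -> tilt u tau != (0, 0).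
Proof.
rewrite -!dot_gt0 => u0.
have -> : dot (tilt u tau) (tilt u tau) = dot u u * (1 + tau ^+ 2).
  by rewrite /dot /tilt /=; ring.
by rewrite mulr_gt0 // ltr_pwDl ?sqr_ge0.
Qed.

(* Turning the box in either direction until a second point reaches one of its
   sides keeps the extremal points, and one of the two turns does not increase
   the area. *)
Lemma extremal_flush P u a b c e :
  u != (0, 0) -> extremal P u a b c e ->
  (exists x y, [/\ x \in P, y \in P & x != y]) ->
  flush_area P (extent_area u a b c e).
Proof.
move=> u0 ext two; have [[aP bP cP eP] hd hc] := ext.
have [[x [xP tie]]|notie] := pselect (exists x, x \in P /\
  [\/ x != a /\ dot u x = dot u a, x != b /\ dot u x = dot u b,
      x != c /\ crs u x = crs u c | x != e /\ crs u x = crs u e]).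
  exact: extremal_tie xP tie.
have sa x : x \in P -> x != a -> dot u a < dot u x.
  move=> xP xa; have /andP[h _] := hd x xP; rewrite lt_neqAle h andbT.
  apply/eqP => tie; apply: notie; exists x; split=> //; apply: Or41; by rewrite tie.
have sb x : x \in P -> x != b -> dot u x < dot u b.
  move=> xP xa; have /andP[_ h] := hd x xP; rewrite lt_neqAle h andbT.
  apply/eqP => tie; apply: notie; exists x; split=> //; apply: Or42; by rewrite tie.
have sc x : x \in P -> x != c -> crs u c < crs u x.
  move=> xP xa; have /andP[h _] := hc x xP; rewrite lt_neqAle h andbT.
  apply/eqP => tie; apply: notie; exists x; split=> //; apply: Or43; by rewrite tie.
have se x : x \in P -> x != e -> crs u x < crs u e.
  move=> xP xa; have /andP[_ h] := hc x xP; rewrite lt_neqAle h andbT.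
  apply/eqP => tie; apply: notie; exists x; split=> //; apply: Or44; by rewrite tie.
(* Each pair is the margin of a point against an extremal point, with its slope: after tilting by
   [tau] the margin is [g.1 + tau * g.2]. The four points stay extremal as long as all margins are
   nonnegative, and a zero margin is a tie. *)
pose G := [seq (dot u x - dot u a, crs u x - crs u a) | x <- P & x != a] ++
  [seq (dot u b - dot u x, crs u b - crs u x) | x <- P & x != b] ++
  [seq (crs u x - crs u c, dot u c - dot u x) | x <- P & x != c] ++
  [seq (crs u e - crs u x, dot u x - dot u e) | x <- P & x != e].
have inG (Q : R * R -> Prop) : (forall g, g \in G -> Q g) <->
   (forall x, x \in P -> [/\ x != a -> Q (dot u x - dot u a, crs u x - crs u a),
     x != b -> Q (dot u b - dot u x, crs u b - crs u x),
     x != c -> Q (crs u x - crs u c, dot u c - dot u x) &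
     x != e -> Q (crs u e - crs u x, dot u x - dot u e)]).
  split=> H.
    move=> x xP; split=> nx; apply: H; rewrite /G !mem_cat; apply/or4P;
    [apply: Or41|apply: Or42|apply: Or43|apply: Or44];
    by apply/mapP; exists x => //; rewrite mem_filter nx.
  by move=> g; rewrite /G !mem_cat => /or4P[] /mapP[x]; rewrite mem_filter => /andP[nx xP] ->;
    have [h1 h2 h3 h4] := H x xP; auto.
have turn tau : (forall g, g \in G -> 0 <= g.1 + tau * g.2) ->
    (exists2 g, g \in G & g.1 + tau * g.2 = 0) ->
    extremal P (tilt u tau) a b c e /\
    flush_area P (extent_area (tilt u tau) a b c e).
  move=> /inG nn [g gG g0].
  have ext' : extremal P (tilt u tau) a b c e.
    split=> // x xP; have [/= h1 h2 h3 h4] := nn x xP; rewrite ?(dot_tilt, crs_tilt);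
      apply/andP; split.
    - by case: (eqVneq x a) => [->//|/h1]; lra.
    - by case: (eqVneq x b) => [->//|/h2]; lra.
    - by case: (eqVneq x c) => [->//|/h3]; lra.
    - by case: (eqVneq x e) => [->//|/h4]; lra.
  split=> //; move: gG; rewrite /G !mem_cat => /or4P[] /mapP[x];
    rewrite mem_filter => /andP[nx xP] eg; rewrite eg /= in g0;
    apply: (extremal_tie (tilt_neq0 _ u0) ext' xP); rewrite !dot_tilt !crs_tilt.
  - by apply: Or41; split=> //; lra.
  - by apply: Or42; split=> //; lra.
  - by apply: Or43; split=> //; lra.
  - by apply: Or44; split=> //; lra.
have G0 g : g \in G -> 0 < g.1.
  move: g; apply/inG => x xP /=.
  by split=> nx; rewrite subr_gt0; [apply: sa|apply: sb|apply: sc|apply: se].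
have distinct : a != b.
  apply/eqP => ab; have [x [y [xP yP xy]]] := two.
  wlog xa : x y xP yP xy / x != a.
    move=> H; case: (eqVneq x a) => [xa|]; last exact: (H x y).
    by apply: (H y x) => //; rewrite eq_sym // -xa.
  by have := sa x xP xa; rewrite ltNge ab; have /andP[_ ->] := hd x xP.
(* If no margin decreased in this turn, [a] and [b] would both coincide with the bottom point [c];
   for the opposite turn, with the top point [e]. *)
have neg1 : exists2 g, g \in G & g.2 < 0.
  apply: contrapT => no.
  have /inG nn : forall g, g \in G -> 0 <= g.2.
    by move=> g gG; rewrite leNgt; apply/negP => g2; apply: no; exists g.
  have ac : a = c.
    apply/eqP; case: (eqVneq a c) => // ac.
    have [/(_ (contra_neq (fun e => esym e) ac)) /= + _ _ _] := nn c cP.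
    by have := sc a aP ac; lra.
  have bc : b = c.
    apply/eqP; case: (eqVneq b c) => // bc.
    have [_ _ /(_ bc) /= + _] := nn b bP.
    by have := sb c cP (contra_neq (fun e => esym e) bc); lra.
  by move/eqP: distinct; apply; rewrite ac bc.
have neg2 : exists2 g, g \in G & - g.2 < 0.
  apply: contrapT => no.
  have /inG nn : forall g, g \in G -> g.2 <= 0.
    by move=> g gG; rewrite leNgt; apply/negP => g2; apply: no; exists g => //; lra.
  have ae : a = e.
    apply/eqP; case: (eqVneq a e) => // ae.
    have [/(_ (contra_neq (fun e => esym e) ae)) /= + _ _ _] := nn e eP.
    by have := se a aP ae; lra.
  have be : b = e.
    apply/eqP; case: (eqVneq b e) => // be.
    have [_ _ _ /(_ be) /=] := nn b bP.
    by have := sb e eP (contra_neq (fun e => esym e) be); lra.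
  by move/eqP: distinct; apply; rewrite ae be.
have [t0 [t00 nn0 z0]] := first_zero G0 neg1.
have [t1 [t10 nn1 z1]] := first_zero G0 neg2.
have [|| ext0 fl0] := turn t0; [exact: nn0 | exact: z0 |].
have [|| ext1 fl1] := turn (- t1).
- by move=> g gG; have := nn1 g gG; lra.
- by have [g gG gz] := z1; exists g => //; lra.
have area_tilt tau : extent_area (tilt u tau) a b c e =
    (dot u b - dot u a + tau * (crs u b - crs u a)) *
    (crs u e - crs u c + tau * (dot u c - dot u e)) / (dot u u * (1 + tau ^+ 2)).
  rewrite /extent_area !dot_tilt !crs_tilt; congr (_ / _); first by ring.
  by rewrite /dot /crs /tilt /=; ring.
have weaken A A' : flush_area P A -> A <= A' -> flush_area P A'.
  move=> [p [q [r [x [y [pq ? ? h]]]]]] AA; exists p, q, r, x, y; split=> //.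
  exact: le_trans AA.
have [_ /(_ b bP)/andP[h1 _] /(_ e eP)/andP[h2 _]] := ext.
have [_ /(_ b bP)/andP[h3 _] /(_ e eP)/andP[h4 _]] := ext0.
have [_ /(_ b bP)/andP[h5 _] /(_ e eP)/andP[h6 _]] := ext1.
rewrite !dot_tilt in h3 h5; rewrite !crs_tilt in h4 h6.
have := @area_quasi_concave (dot u b - dot u a) (crs u b - crs u a)
  (crs u e - crs u c) (dot u c - dot u e) (dot u u) t0 t1.
rewrite dot_gt0 => /(_ u0 t00 t10)[]; try lra.
- by rewrite -area_tilt; exact: weaken fl0.
- move: (area_tilt (- t1)); rewrite sqrrN !mulNr => <-; exact: weaken fl1.
Qed.

End Flush.

(** * Boxes in the coordinates of a direction *)

Section Boxes.
Variable R : realType.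
Implicit Types (u d x y p q : R * R) (P S X : seq (R * R)) (r : rect R).

(* (d, a, b, c, e) stands for the box a <= dot d x <= b, c <= crs d x <= e. *)
Definition slab : Type := (R * R * R * R * R * R)%type.

(** The vertex solves [dot d v = a], [crs d v = c], and the sides point along [d] and [turn90 d].
    Dividing by [dot d d] keeps everything within the field operations of the machine. *)
Definition box (t : slab) : rect R :=
  let: (d, a, b, c, e) := t in let N := dot d d in
  Rect ((a * d.1 - c * d.2) / N, (a * d.2 + c * d.1) / N)
       ((b - a) * d.1 / N, (b - a) * d.2 / N)
       (- ((e - c) * d.2 / N), (e - c) * d.1 / N).

Definition slab_area (t : slab) : R :=
  let: (d, a, b, c, e) := t in (b - a) * (e - c) / dot d d.

Definition in_slab (t : slab) x : bool :=
  let: (d, a, b, c, e) := t in (a <= dot d x <= b) && (c <= crs d x <= e).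

(** Open in the lateral direction only: the scan of a strip controls what lies strictly between the
    lateral sides, with bottom and top included. *)
Definition in_open_slab (t : slab) x : bool :=
  let: (d, a, b, c, e) := t in (a < dot d x < b) && (c <= crs d x <= e).

Definition proper_slab (t : slab) : bool :=
  let: (d, a, b, c, e) := t in [&& d != (0, 0), a <= b & c <= e].

Lemma is_rect_box t : is_rect (box t).
Proof. by case: t => -[[[d a] b] c] e; rewrite /is_rect /=; ring. Qed.

Lemma area_box t : proper_slab t -> area (box t) = slab_area t.
Proof.
case: t => -[[[d a] b] c] e /and3P[]; rewrite -dot_gt0 => N0 ab ce.
have N1 : dot d d != 0 by rewrite gt_eqF.
rewrite /area /norm2 /= -sqrtrM ?addr_ge0 ?sqr_ge0 //.
have v0 : 0 <= (b - a) * (e - c) / dot d d.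
  by rewrite divr_ge0 ?mulr_ge0 ?subr_ge0 // ltW.
rewrite -[RHS]ger0_norm // -sqrtr_sqr; congr Num.sqrt.
by move: N1; rewrite /dot => N1; field.
Qed.

Lemma in_rect_box t x : proper_slab t -> in_rect (box t) x <-> in_slab t x.
Proof.
case: t => -[[[d a] b] c] e /and3P[]; rewrite -dot_gt0 => N0 ab ce.
have N1 : dot d d != 0 by rewrite gt_eqF.
split=> [[al [be [/andP[a0 a1] /andP[b0 b1] e1 e2]]]|/andP[/andP[h1 h2] /andP[h3 h4]]].
- have -> : in_slab (d, a, b, c, e) x = (a <= dot d x <= b) && (c <= crs d x <= e) by [].
  have -> : dot d x = a + al * (b - a).
    by rewrite /dot e1 e2 /=; move: N1; rewrite /dot => N1; field.
  have -> : crs d x = c + be * (e - c).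
    by rewrite /crs e1 e2 /=; move: N1; rewrite /dot => N1; field.
  by apply/andP; split; apply/andP; split; nra.
- have frac (s t v : R) : s <= v -> v <= t -> exists2 z, 0 <= z <= 1 & z * (t - s) = v - s.
    (* On a side of length zero the parameter is arbitrary; 0 is taken. *)
    move=> sv vt; case: (eqVneq s t) => [st|st].
      by exists 0; rewrite ?lexx ?ler01 //; lra.
    have st0 : 0 < t - s by rewrite subr_gt0 lt_neqAle st (le_trans sv).
    exists ((v - s) / (t - s)); last by rewrite divfK // gt_eqF.
    apply/andP; split; first by apply: divr_ge0; rewrite subr_ge0 // ltW // -subr_gt0.
    by rewrite ler_pdivrMr // mul1r lerB.
  have [al al1 ea] := frac _ _ _ h1 h2; have [be be1 eb] := frac _ _ _ h3 h4.
  exists al, be; split=> //=; rewrite !mulrA ?mulrN ?mulrA ea eb /dot /crs;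
    move: N1; rewrite /dot => N1; by field.
Qed.

Lemma exists_extremal P u : P != [::] -> exists a b c e, extremal P u a b c e.
Proof.
move=> P0.
have [a aP ha] := exists_argmin (dot u) P0.
have [b bP hb] := exists_argmin (fun x => - dot u x) P0.
have [c cP hc] := exists_argmin (crs u) P0.
have [e eP he] := exists_argmin (fun x => - crs u x) P0.
exists a, b, c, e; split=> // x xP.
  by rewrite ha //= -lerN2 hb.
by rewrite hc //= -lerN2 he.
Qed.

(** The direction is that of the first side, or of the second if the first vanishes. If both vanish
    the rectangle is a point, which the two distinct points exclude. *)
Lemma rect_extent r : is_rect r ->
  (exists x y, [/\ in_rect r x, in_rect r y & x != y]) ->
  exists u A H, [/\ u != (0, 0), area r = A * H / dot u u &
    forall x y, in_rect r x -> in_rect r y ->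
      dot u x - dot u y <= A /\ crs u x - crs u y <= H].
Proof.
case: r => v s1 s2; rewrite /is_rect /area /norm2 /= => orth two.
have range (z z' w : R) : 0 <= z <= 1 -> 0 <= z' <= 1 -> (z - z') * w <= `|w|.
  move=> /andP[h1 h2] /andP[h3 h4]; apply: le_trans (ler_norm _) _.
  rewrite normrM ler_piMl // ler_norml; lra.
case: (eqVneq s1 (0, 0)) => [e1|n1].
  case: (eqVneq s2 (0, 0)) => [e2|n2].
    have [x [y [[? [? [_ _ hx1 hx2]]] [? [? [_ _ hy1 hy2]]] /eqP[]]]] := two.
    case: x hx1 hx2 => x1 x2 /= -> ->; case: y hy1 hy2 => y1 y2 /= -> ->.
    by rewrite e1 e2 /= !mulr0 !addr0.
  exists s2, (dot s2 s2), 0; split=> //.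
    by rewrite e1 /= expr0n /= addr0 sqrtr0 !(mul0r, mulr0).
  move=> x y [a [b [ha hb hx1 hx2]]] [a' [b' [ha' hb' hy1 hy2]]]; split.
    have -> : dot s2 x - dot s2 y = (b - b') * dot s2 s2.
      by rewrite /dot hx1 hx2 hy1 hy2 e1 /=; ring.
    apply: le_trans (range _ _ _ hb hb') _.
    by rewrite ger0_norm // ltW // dot_gt0.
  by rewrite /crs hx1 hx2 hy1 hy2 e1 /= le_eqVlt; apply/orP; left; apply/eqP; ring.
have N0 : 0 < dot s1 s1 by rewrite dot_gt0.
exists s1, (dot s1 s1), `|crs s1 s2|; split=> //.
  rewrite mulrAC divff ?gt_eqF // mul1r -sqrtrM ?addr_ge0 ?sqr_ge0 //.
  rewrite -sqrtr_sqr; congr Num.sqrt.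
  have -> : (s1.1 ^+ 2 + s1.2 ^+ 2) * (s2.1 ^+ 2 + s2.2 ^+ 2) =
    crs s1 s2 ^+ 2 + (s1.1 * s2.1 + s1.2 * s2.2) ^+ 2 by rewrite /crs; ring.
  by rewrite orth expr0n addr0.
move=> x y [a [b [ha hb hx1 hx2]]] [a' [b' [ha' hb' hy1 hy2]]]; split.
  have -> : dot s1 x - dot s1 y = (a - a') * dot s1 s1.
    rewrite /dot hx1 hx2 hy1 hy2 /=.
    rewrite -[RHS]addr0 -(mulr0 (b - b')) -orth; ring.
  apply: le_trans (range _ _ _ ha ha') _.
  by rewrite ger0_norm // ltW.
have -> : crs s1 x - crs s1 y = (b - b') * crs s1 s2.
  by rewrite /crs hx1 hx2 hy1 hy2 /=; ring.
exact: range.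
Qed.

Lemma rect_flush P r : is_rect r -> (forall x, x \in P -> in_rect r x) ->
  (exists x y, [/\ x \in P, y \in P & x != y]) -> flush_area P (area r).
Proof.
move=> rr Pr two.
have [|u [A [H [u0 -> hAH]]]] := rect_extent rr.
  by have [x [y [xP yP xy]]] := two; exists x, y; split=> //; apply: Pr.
have P0 : P != [::] by have [x [_ [xP _ _]]] := two; case: (P) xP.
have [a [b [c [e ext]]]] := exists_extremal u P0.
have [p [q [z [x [y [pq qP ext' le]]]]]] := extremal_flush u0 ext two.
exists p, q, z, x, y; split=> //; apply: le_trans le _.
have [[aP bP cP eP] /(_ b bP)/andP[h1 _] /(_ e eP)/andP[h2 _]] := ext.
have [h3 _] := hAH b a (Pr _ bP) (Pr _ aP).
have [_ h4] := hAH e c (Pr _ eP) (Pr _ cP).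
have D0 : 0 < dot u u by rewrite dot_gt0.
by rewrite /extent_area ler_wpM2r ?invr_ge0 ?(ltW D0) // ler_pM ?subr_ge0.
Qed.

(** * Candidate boxes of a finite list of points *)

Section Candidates.
Variables (S : seq (R * R)) (s : nat).

Definition strip_keys p q z : seq R :=
  let d := vsub q p in
  sort <=%R [seq dot d x | x <- S & crs d p <= crs d x <= crs d z].

Definition cands3 p q z : seq slab :=
  let d := vsub q p in
  [seq (d, w.1, w.2, crs d p, crs d z) | w <- windows s (strip_keys p q z)].

(** In a sample with repetitions, different indices may carry the same point; such a pair has no
    direction. The program detects it by [dot d d = 0]. *)
Definition cands2 p q : seq slab :=
  if p == q then [::] else flatten [seq cands3 p q z | z <- S].

Definition cands1 p : seq slab := flatten [seq cands2 p q | q <- S].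

Definition cands : seq slab := flatten [seq cands1 p | p <- S].

Definition cand_of (p q z x y : R * R) : slab :=
  let d := vsub q p in (d, dot d x, dot d y, crs d p, crs d z).

Lemma candsP t : reflect
  (exists p q z, [/\ [/\ p \in S, q \in S & z \in S], p != q & t \in cands3 p q z])
  (t \in cands).
Proof.
apply: (iffP flatten_mapP) => [[p pS /flatten_mapP[q qS]]|[p [q [z [[pS qS zS] pq h]]]]].
  rewrite /cands2; case: eqVneq => // pq /flatten_mapP[z zS h].
  by exists p, q, z.
exists p => //; apply/flatten_mapP; exists q => //.
by rewrite /cands2 (negPf pq); apply/flatten_mapP; exists z.
Qed.

Lemma vsub_neq0 p q : (vsub q p != (0, 0)) = (p != q).
Proof.
case: p q => p1 p2 [q1 q2]; rewrite /vsub !xpair_eqE /= !subr_eq0.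
by rewrite (eq_sym p1) (eq_sym p2).
Qed.

Lemma strip_keys_sorted p q z : sorted <=%R (strip_keys p q z).
Proof. exact: sort_sorted (@le_total _ _) _. Qed.

Lemma strip_keys_mem p q z v : v \in strip_keys p q z ->
  exists2 x, x \in S & v = dot (vsub q p) x /\
    crs (vsub q p) p <= crs (vsub q p) x <= crs (vsub q p) z.
Proof.
rewrite mem_sort => /mapP[x]; rewrite mem_filter => /andP[h xS] ->.
by exists x.
Qed.

Lemma count_strip_keys p q z (Q : pred R) :
  count Q (strip_keys p q z) =
  count (fun x => Q (dot (vsub q p) x) &&
     (crs (vsub q p) p <= crs (vsub q p) x <= crs (vsub q p) z)) S.
Proof.
rewrite /strip_keys (permP (permEl (perm_sort _ _))) count_map count_filter.
by apply: eq_count.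
Qed.

Hypothesis s_gt0 : (0 < s)%N.

(** Five points of [S] place the box in the finite family of the union bound; the closed and the
    open count serve the lower and the upper bound on the enclosed points. *)
Lemma cands_sound t : t \in cands ->
  exists p q z x y, [/\ [/\ p \in S, q \in S, z \in S, x \in S & y \in S],
    t = cand_of p q z x y, proper_slab t, 
    (s <= count (in_slab t) S)%N & (count (in_open_slab t) S < s)%N].
Proof.
move=> /candsP[p [q [z [[pS qS zS] pq]]]].
have sB := strip_keys_sorted p q z.
move=> /mapP[[a b] w ->].
have [aB bB] := windows_mem s_gt0 w.
have [x xS [ea /andP[h1 h2]]] := strip_keys_mem aB.
have [y yS [eb _]] := strip_keys_mem bB.
exists p, q, z, x, y; split=> //=.
- by rewrite /cand_of -ea -eb.
- by rewrite vsub_neq0 pq (windows_le s_gt0 sB w) (le_trans h1).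
- by have := windows_closed_count s_gt0 sB w; rewrite /closed_count count_strip_keys.
- by have := windows_open_count s_gt0 sB w; rewrite /open_count count_strip_keys.
Qed.

(** The flush box of the enclosed points has [p], [q] on its bottom side and a point of [S] on its
    top side. Its lateral extent contains [s] keys of that strip, so a window inside it yields a
    candidate of no larger area. *)
Lemma cands_minimal r : is_rect r ->
  (s <= count (fun x => `[< in_rect r x >]) S)%N ->
  (exists x y, [/\ x \in S, y \in S, in_rect r x, in_rect r y & x != y]) ->
  exists2 t, t \in cands & slab_area t <= area r.
Proof.
move=> rr cnt two; pose P := [seq x <- S | `[< in_rect r x >]].
have PS x : x \in P -> x \in S by rewrite mem_filter => /andP[].
have [||p [q [z [x [y [pq qP [[xP yP pP zP] hd hc] le]]]]]] := @rect_flush P r rr.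
- by move=> x; rewrite mem_filter => /andP[/asboolP].
- have [x [y [xS yS xr yr xy]]] := two; exists x, y.
  by rewrite !mem_filter xS yS !andbT; split=> //; apply/asboolP.
have [|a [b [w ha hb]]] := @windows_minimal _ s (strip_keys p q z)
  (dot (vsub q p) x) (dot (vsub q p) y) s_gt0 (strip_keys_sorted _ _ _).
  rewrite /closed_count count_strip_keys; apply: leq_trans cnt _.
  apply: sub_in_count => v vS vr; have vP : v \in P by rewrite mem_filter vr.
  by rewrite hd // hc.
have ab := windows_le s_gt0 (strip_keys_sorted _ _ _) w.
exists (vsub q p, a, b, crs (vsub q p) p, crs (vsub q p) z).
  apply/candsP; exists p, q, z; split=> //; first by split; apply: PS.
  by apply/mapP; exists (a, b).
apply: le_trans le; rewrite /extent_area /=.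
have D0 : 0 < dot (vsub q p) (vsub q p) by rewrite dot_gt0 vsub_neq0.
have cz : crs (vsub q p) p <= crs (vsub q p) z by case/andP: (hc z zP).
by rewrite ler_wpM2r ?invr_ge0 ?(ltW D0) // ler_wpM2r ?subr_ge0 // lerB.
Qed.

End Candidates.

Lemma line_count X d (v : R) : uniq X -> no_three_collinear X -> d != (0, 0) ->
  (count (fun x => dot d x == v) X <= 2)%N.
Proof.
move=> uX nX d0; rewrite leqNgt -size_filter; apply/negP.
set L := filter _ X; have uL : uniq L by rewrite filter_uniq.
have inL x : x \in L -> x \in X /\ dot d x = v.
  by rewrite mem_filter => /andP[/eqP].
case: L uL inL => // x [//|y [//|z L]] /= /and4P[]; rewrite !inE !negb_or.
move=> /and3P[xy xz _] /andP[yz _] _ _ inL _.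
have [xX ex] := inL x (mem_head _ _).
have [yX ey] : y \in X /\ dot d y = v by apply: inL; rewrite !inE eqxx orbT.
have [zX ez] : z \in X /\ dot d z = v by apply: inL; rewrite !inE eqxx !orbT.
apply: (nX x y z) => //; exists d.1, d.2, v; split=> //.
Qed.

Lemma cands_count_le S s t : (0 < s)%N -> uniq S -> no_three_collinear S ->
  t \in cands S s -> (count (in_slab t) S <= s.+1)%N.
Proof.
move=> s0 uS nS /candsP[p [q [z [_ pq]]]] /mapP[[a b] w ->] /=.
have := windows_closed_count_le s0 (strip_keys_sorted S p q z) _ w.
rewrite /closed_count count_strip_keys; apply => v.
rewrite count_strip_keys; apply: leq_trans (line_count v uS nS _); last first.
  by rewrite -vsub_neq0 in pq; exact: pq.
by apply: sub_count => x /andP[].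
Qed.

Lemma in_slab_count_open X t : uniq X -> no_three_collinear X -> proper_slab t ->
  (count (in_slab t) X <= count (in_open_slab t) X + 4)%N.
Proof.
case: t => -[[[d a] b] c] e uX nX /and3P[d0 _ _].
have ha := line_count a uX nX d0; have hb := line_count b uX nX d0.
set f := fun x => dot d x == a; set g := fun x => dot d x == b.
have : (count (predU (in_open_slab (d, a, b, c, e)) (predU f g)) X <=
    count (in_open_slab (d, a, b, c, e)) X + (count f X + count g X))%N.
  have h1 := count_predUI f g X.
  have h2 := count_predUI (in_open_slab (d, a, b, c, e)) (predU f g) X.
  lia.
suff : (count (in_slab (d, a, b, c, e)) X <=
   count (predU (in_open_slab (d, a, b, c, e)) (predU f g)) X)%N by rewrite /f /g in ha hb *; lia.
apply: sub_count => x /andP[/andP[h1 h2] h3]; rewrite /= /f /g.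
move: h1 h2; rewrite (le_eqVlt a) (le_eqVlt _ b) => /predU1P[->|h1]; first by rewrite eqxx orbT.
move=> /predU1P[->|h2]; first by rewrite eqxx !orbT.
by rewrite h1 h2 h3.
Qed.

Lemma enclosed_box X t : proper_slab t -> enclosed (box t) X = count (in_slab t) X.
Proof.
move=> pt; apply: eq_count => x; apply/asboolP/idP; by move/(in_rect_box x pt).
Qed.

End Boxes.

(** * Mean over random words *)

Section Sampling.
Variable R : realType.
Implicit Types (n m k : nat) (G H : seq nat -> R) (c : pred nat).

(** Expectation over [m] independent uniform draws from [0, ..., n - 1], unfolded from the first
    draw so as to follow the execution of the drawing loop. *)
Fixpoint avg n m G : R :=
  if m is m'.+1 then (\sum_(0 <= v < n) avg n m' (fun w => G (v :: w))) / n%:R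
  else G [::].

Lemma avg_le n m G H :
  (forall w, size w = m -> all (ltn^~ n) w -> G w <= H w) ->
  avg n m G <= avg n m H.
Proof.
elim: m G H => [|m IH] G H GH /=; first exact: GH.
rewrite ler_wpM2r ?invr_ge0 ?ler0n // !big_nat ler_sum // => v /andP[_ vn].
by apply: IH => w sw aw; apply: GH; rewrite /= ?sw ?vn.
Qed.

Lemma avg_sub n m G H :
  avg n m (fun w => G w - H w) = avg n m G - avg n m H.
Proof.
elim: m G H => [|m IH] G H //=.
by rewrite -mulrBl -sumrB; under eq_bigr do rewrite IH.
Qed.

Lemma avg_scale n m (a : R) G : avg n m (fun w => G w * a) = avg n m G * a.
Proof.
elim: m G => [|m IH] G //=.
rewrite [RHS]mulrAC [in RHS]mulr_suml; congr (_ / _).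
by apply: eq_bigr => v _; rewrite IH.
Qed.

(** Independence of the draws. *)
Lemma avg_prod n m (phi : nat -> R) :
  avg n m (fun w => \prod_(v <- w) phi v) =
  ((\sum_(0 <= v < n) phi v) / n%:R) ^+ m.
Proof.
elim: m => [|m IH] /=; first by rewrite big_nil expr0.
rewrite exprS -IH mulrAC; congr (_ / _); rewrite mulr_suml.
apply: eq_bigr => v _; rewrite mulrC -avg_scale; congr avg.
by apply/funext => w; rewrite big_cons mulrC.
Qed.

Lemma avg1 n m : (0 < n)%N -> avg n m (fun=> 1) = 1.
Proof.
move=> n0; elim: m => //= m ->; rewrite big_const_nat subn0 iter_addr_0.
by rewrite divff // pnatr_eq0 -lt0n.
Qed.

(** The union bound, written with indicators. *)
Lemma avg_all (T : Type) n m (F : seq T) (bad : T -> pred (seq nat)) (beta : R) :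
  (0 < n)%N -> (forall t, avg n m (fun w => (bad t w)%:R) <= beta) ->
  1 - (size F)%:R * beta <= avg n m (fun w => (all (fun t => ~~ bad t w) F)%:R).
Proof.
move=> n0 hb; elim: F => [|t F IH] /=; first by rewrite avg1 // mul0r subr0.
apply: (@le_trans _ _ (avg n m (fun w => (all (fun t => ~~ bad t w) F)%:R) -
   avg n m (fun w => (bad t w)%:R))).
  by rewrite -natr1; have := hb t; lra.
rewrite -avg_sub; apply: avg_le => w _ _.
by case: (bad t w); case: all; rewrite /= ?subr0 ?subrr ?sub0r ?lerN10.
Qed.

(** Moment generating function of a binomial variable, with base [1 + a] instead of an exponential;
    [a > 0] serves the upper tail and [a < 0] the lower one. *)
Lemma avg_pow_count n m c (a : R) : (0 < n)%N ->
  avg n m (fun w => (1 + a) ^+ count c w) =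
  (1 + a * (count c (iota 0 n))%:R / n%:R) ^+ m.
Proof.
move=> n0; have prodE (w : seq nat) :
    \prod_(v <- w) (if c v then 1 + a else 1) = (1 + a) ^+ count c w.
  by rewrite -iter_mulr_1 -big_mkcond big_const_seq.
transitivity (avg n m (fun w => \prod_(v <- w) (if c v then 1 + a else 1))).
  by congr avg; apply/funext => w; rewrite prodE.
rewrite avg_prod; congr (_ ^+ _).
have -> : \sum_(0 <= v < n) (if c v then 1 + a else 1) =
    n%:R + a * (count c (iota 0 n))%:R.
  rewrite (eq_bigr (fun v => 1 + (if c v then a else 0))); last first.
    by move=> v _; case: (c v); rewrite ?addr0.
  rewrite big_split /= big_const_nat subn0 iter_addr_0; congr (_ + _).
  by rewrite -big_mkcond /index_iota subn0 big_const_seq /= iter_addr_0 mulr_natr.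
by rewrite mulrDl divff // pnatr_eq0 -lt0n.
Qed.

(** Follows from [exp (- y) >= 1 - y] at [y = x - x^2] and [(1 + x) (1 - x + x^2) = 1 + x^3]. *)
Lemma expR_le_1D (x : R) : 0 <= x <= 1 -> expR (x - x ^+ 2) <= 1 + x.
Proof.
move=> /andP[x0 x1].
have h : 0 < 1 - (x - x ^+ 2) by nra.
rewrite -[leLHS]opprK -[x - x ^+ 2]opprK expRN opprK.
apply: (@le_trans _ _ (1 - (x - x ^+ 2))^-1).
  rewrite lef_pV2 ?posrE ?expR_gt0 //.
  by have := expR_ge1Dx (- (x - x ^+ 2)).
rewrite -div1r ler_pdivrMr //; have := exprn_ge0 3 x0; lra.
Qed.

(** Follows from [exp y >= 1 + y] at [y = x + 2 x^2] and [(1 - x) (1 + x + 2 x^2) = 1 + x^2 (1 - 2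
    x)]. *)
Lemma expR_le_1B (x : R) : 0 <= x <= 1 / 2 -> expR (- (x + 2 * x ^+ 2)) <= 1 - x.
Proof.
move=> /andP[x0 x1]; have x2 := sqr_ge0 x.
have h : 0 < 1 + (x + 2 * x ^+ 2) by lra.
rewrite expRN; apply: (@le_trans _ _ (1 + (x + 2 * x ^+ 2))^-1).
  by rewrite lef_pV2 ?posrE ?expR_gt0 // expR_ge1Dx.
rewrite -div1r ler_pdivrMr //.
have : 0 <= x ^+ 2 * (1 - 2 * x) by rewrite mulr_ge0 //; lra.
lra.
Qed.

Lemma expr_count_base_le (a b : R) n m c : (0 < n)%N -> 0 <= 1 + a ->
  a * (count c (iota 0 n))%:R / n%:R <= b ->
  avg n m (fun w => (1 + a) ^+ count c w) <= expR (m%:R * b).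
Proof.
move=> n0 a0 h; rewrite avg_pow_count // [m%:R * b]mulrC expRM_natr.
rewrite lerXn2r ?nnegrE ?expR_ge0 //.
  have n1 : 0 < n%:R :> R by rewrite ltr0n.
  have : (count c (iota 0 n))%:R <= n%:R :> R.
    by rewrite ler_nat (leq_trans (count_size _ _)) ?size_iota.
  move=> cn; have -> : 1 + a * (count c (iota 0 n))%:R / n%:R =
     (n%:R + a * (count c (iota 0 n))%:R) / n%:R by field; rewrite gt_eqF.
  rewrite divr_ge0 ?(ltW n1) //; have := ler0n R (count c (iota 0 n)); nra.
by apply: le_trans (expR_ge1Dx b); rewrite lerD2l.
Qed.

(** Chernoff bound: Markov's inequality for [(1 + x) ^ count]. The rate [p] may be any upper bound
    of the threshold rate [q]. *)
Lemma tail_upper n m k c (dl p q p0 : R) :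
  (0 < n)%N -> 0 < dl -> dl <= p -> 0 <= q -> q <= p ->
  (count c (iota 0 n))%:R <= p0 * n%:R -> p0 + dl <= q ->
  m%:R * q <= k.+1%:R ->
  avg n m (fun w => (k < count c w)%N%:R) <= expR (- (m%:R * dl ^+ 2 / (8 * p))).
Proof.
move=> n_gt0 dl_gt0 dl_le q_ge0 q_le hp0 hq hk.
have p_gt0 : 0 < p := lt_le_trans dl_gt0 dl_le.
have n1 : 0 < n%:R :> R by rewrite ltr0n.
(* The exponent per draw is at most [- x dl + x^2 p], which this [x] minimises, with value
   [- dl^2 / (4 p)]; half of it is kept. *)
set x := dl / (2 * p).
have x0 : 0 < x by rewrite divr_gt0 // mulr_gt0.
have xp : x * (2 * p) = dl by rewrite divfK // gt_eqF // mulr_gt0.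
have x1 : x <= 1 by rewrite /x ler_pdivrMr; [lra | rewrite mulr_gt0].
apply: (@le_trans _ _ (avg n m (fun w => (1 + x) ^+ count c w / (1 + x) ^+ k.+1))).
  apply: avg_le => w _ _; case: ltnP => h.
    rewrite ler_pdivlMr ?exprn_gt0 ?addr_gt0 // mul1r ler_weXn2l //; lra.
  by rewrite divr_ge0 ?exprn_ge0 // addr_ge0 // ltW.
rewrite avg_scale.
have e1 : avg n m (fun w => (1 + x) ^+ count c w) <= expR (m%:R * (x * p0)).
  apply: expr_count_base_le => //; first by rewrite addr_ge0 // ltW.
  by rewrite -mulrA ler_pM2l // ler_pdivrMr.
have e2 : ((1 + x) ^+ k.+1)^-1 <= expR (- ((x - x ^+ 2) * k.+1%:R)).
  rewrite expRN lef_pV2 ?posrE ?expR_gt0 ?exprn_gt0 ?addr_gt0 // expRM_natr.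
  rewrite lerXn2r ?nnegrE ?expR_ge0 ?addr_ge0 ?(ltW x0) //.
  by apply: expR_le_1D; rewrite (ltW x0).
apply: le_trans (ler_pM _ _ e1 e2) _.
- by rewrite avg_pow_count // exprn_ge0 // addr_ge0 // divr_ge0 // mulr_ge0 // ltW.
- by rewrite invr_ge0 exprn_ge0 // addr_ge0 // ltW.
rewrite -expRD ler_expR.
have -> : m%:R * dl ^+ 2 / (8 * p) = m%:R * (x ^+ 2 * p / 2).
  by rewrite -xp; field; rewrite gt_eqF.
have y0 : 0 <= x - x ^+ 2 by nra.
have h1 : (x - x ^+ 2) * (m%:R * q) <= (x - x ^+ 2) * k.+1%:R by rewrite ler_wpM2l.
have m0 : 0 <= m%:R :> R by rewrite ler0n.
have h2 : x * p0 - (x - x ^+ 2) * q <= - (x ^+ 2 * p / 2).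
  have : x * (p0 + dl) <= x * q by rewrite ler_pM2l.
  have : x ^+ 2 * q <= x ^+ 2 * p by rewrite ler_wpM2l ?sqr_ge0.
  have : 0 <= x ^+ 2 * p by rewrite mulr_ge0 ?sqr_ge0 // ltW.
  by rewrite mulrDr -xp; lra.
have := ler_wpM2l m0 h2; lra.
Qed.

Lemma tail_lower n m k c (dl p q p1 : R) :
  (0 < n)%N -> 0 < dl -> dl <= p -> 0 <= q -> q <= p ->
  p1 * n%:R <= (count c (iota 0 n))%:R -> q + dl <= p1 ->
  k%:R <= m%:R * q ->
  avg n m (fun w => (count c w <= k)%N%:R) <= expR (- (m%:R * dl ^+ 2 / (8 * p))).
Proof.
move=> n_gt0 dl_gt0 dl_le q_ge0 q_le hp1 hq hk.
have p_gt0 : 0 < p := lt_le_trans dl_gt0 dl_le.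
have n1 : 0 < n%:R :> R by rewrite ltr0n.
(* Here [expR_le_1B] gives [- x dl + 2 x^2 p] per draw; this [x] is its minimiser, with value
   [- dl^2 / (8 p)]. *)
set x := dl / (4 * p).
have x0 : 0 < x by rewrite divr_gt0 // mulr_gt0.
have xp : x * (4 * p) = dl by rewrite divfK // gt_eqF // mulr_gt0.
have x1 : x <= 1 / 2 by rewrite /x ler_pdivrMr; [lra | rewrite mulr_gt0].
have y0 : 0 < 1 - x by lra.
apply: (@le_trans _ _ (avg n m (fun w => (1 + - x) ^+ count c w / (1 - x) ^+ k))).
  apply: avg_le => w _ _; case: leqP => h.
    rewrite ler_pdivlMr ?exprn_gt0 // mul1r ler_wiXn2l //; lra.
  by rewrite divr_ge0 ?exprn_ge0 // ltW.
rewrite avg_scale.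
have e1 : avg n m (fun w => (1 + - x) ^+ count c w) <= expR (m%:R * - (x * p1)).
  apply: expr_count_base_le => //; first exact: ltW.
  by rewrite mulNr mulNr lerN2 -mulrA ler_pM2l // ler_pdivlMr.
have e2 : ((1 - x) ^+ k)^-1 <= expR ((x + 2 * x ^+ 2) * k%:R).
  rewrite -[leRHS]invrK -expRN lef_pV2 ?posrE ?expR_gt0 ?exprn_gt0 //.
  rewrite -mulNr expRM_natr lerXn2r ?nnegrE ?expR_ge0 ?(ltW y0) //.
  by apply: expR_le_1B; rewrite (ltW x0).
have base : 0 <= 1 + - x * (count c (iota 0 n))%:R / n%:R.
  have cn : (count c (iota 0 n))%:R <= n%:R :> R.
    by rewrite ler_nat (leq_trans (count_size _ _)) ?size_iota.
  rewrite -mulrA mulNr; set y := _ / n%:R.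
  have y1 : y <= 1 by rewrite ler_pdivrMr // mul1r.
  have y2 : 0 <= y by rewrite divr_ge0.
  have : x * y <= 1 * 1 by rewrite ler_pM //; lra.
  by rewrite mulr1; lra.
apply: le_trans (ler_pM _ _ e1 e2) _.
- by rewrite avg_pow_count // exprn_ge0.
- by rewrite invr_ge0 exprn_ge0 // ltW.
rewrite -expRD ler_expR.
have -> : m%:R * dl ^+ 2 / (8 * p) = m%:R * (2 * x ^+ 2 * p).
  by rewrite -xp; field; rewrite gt_eqF.
have z0 : 0 <= x + 2 * x ^+ 2 by nra.
have h1 : (x + 2 * x ^+ 2) * k%:R <= (x + 2 * x ^+ 2) * (m%:R * q) by rewrite ler_wpM2l.
have m0 : 0 <= m%:R :> R by rewrite ler0n.
have h2 : - (x * p1) + (x + 2 * x ^+ 2) * q <= - (2 * x ^+ 2 * p).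
  have : x * (q + dl) <= x * p1 by rewrite ler_pM2l.
  have : x ^+ 2 * q <= x ^+ 2 * p by rewrite ler_wpM2l ?sqr_ge0.
  by rewrite mulrDr -xp; lra.
have := ler_wpM2l m0 h2; lra.
Qed.

End Sampling.

(** * The search for a smallest box *)

Section RankSort.
Variables (R : realType) (m : nat) (key : nat -> R).

(** Breaking ties by index makes the ranks distinct, so writing each index at its rank sorts. This
    takes quadratic time per pair [(p, q)], which still fits into [m^4]. *)
Definition lexle (i j : nat) : bool := 
  (key i < key j) || ~~ (key j < key i) && (i <= j)%N.
Definition lexlt (i j : nat) : bool :=
  (key i < key j) || ~~ (key j < key i) && (i < j)%N.
Definition rank (i : nat) : nat := count (lexlt^~ i) (iota 0 m).
Definition order : seq nat := sort lexle (iota 0 m).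

Lemma lexle_total : total lexle.
Proof.
by move=> i j; rewrite /lexle; case: (ltgtP (key i) (key j)) => //= _; apply: leq_total.
Qed.

Lemma lexle_trans : transitive lexle.
Proof.
move=> j i k; rewrite /lexle -!leNgt => /orP[ij|/andP[ij ij']] /orP[jk|/andP[jk jk']].
- by rewrite (lt_trans ij jk).
- by rewrite (lt_le_trans ij jk).
- by rewrite (le_lt_trans ij jk).
- by rewrite (le_trans ij jk) (leq_trans ij' jk') orbT.
Qed.

Lemma lexltNle i j : lexlt i j = ~~ lexle j i.
Proof.
by rewrite /lexlt /lexle; case: (ltgtP (key i) (key j)) => //= _; rewrite ltnNge.
Qed.

Lemma lexle_anti i j : lexle i j -> lexle j i -> i = j.
Proof.
by rewrite /lexle; case: (ltgtP (key i) (key j)) => //= _ h1 h2; apply/eqP; rewrite eqn_leq h1.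
Qed.

Lemma perm_order : perm_eq order (iota 0 m).
Proof. exact: permEl (perm_sort _ _). Qed.

Lemma size_order : size order = m.
Proof. by rewrite size_sort size_iota. Qed.

Lemma sorted_order : sorted lexle order.
Proof. exact: sort_sorted lexle_total _. Qed.

Lemma mem_order i : (i \in order) = (i < m)%N.
Proof. by rewrite mem_sort mem_iota. Qed.

Lemma uniq_order : uniq order.
Proof. by rewrite sort_uniq iota_uniq. Qed.

Lemma rank_order k : (k < m)%N -> rank (nth 0%N order k) = k.
Proof.
move=> km; rewrite /rank -(permP perm_order) (count_nth_iota 0%N) size_order.
have k0 : (0 + k <= m)%N by rewrite ltnW.
rewrite -[RHS](count_interval_iota k0); apply: eq_in_count => i.
rewrite mem_iota /= add0n => im; rewrite lexltNle.
have lxx : reflexive lexle by move=> x; rewrite /lexle ltxx leqnn.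
have leO a b : (a <= b < m)%N -> lexle (nth 0%N order a) (nth 0%N order b).
  move=> /andP[ab bm]; apply: (sorted_leq_nth lexle_trans lxx _ sorted_order) => //;
    by rewrite inE size_order // (leq_ltn_trans ab).
case: (ltnP i k) => ik.
  apply/negP => h; have := lexle_anti h (leO _ _ _); rewrite (ltnW ik) km => /(_ isT) /eqP.
  by rewrite nth_uniq ?size_order ?uniq_order // gtn_eqF.
by rewrite leO // ik.
Qed.

Lemma rank_inj i j : (i < m)%N -> (j < m)%N -> rank i = rank j -> i = j.
Proof.
move=> im jm; have {im} : i \in order by rewrite mem_order.
have {jm} : j \in order by rewrite mem_order.
move=> /(nthP 0%N)[b + <-] /(nthP 0%N)[a + <-]; rewrite size_order => bm am.
by rewrite !rank_order // => ->.
Qed.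

Lemma sorted_keys (P : pred nat) : sorted <=%R [seq key o | o <- order & P o].
Proof.
rewrite sorted_map; apply: (@sub_sorted _ lexle).
  move=> i j; rewrite /lexle /= => /orP[/ltW //|]; by rewrite -leNgt => /andP[].
exact: sorted_filter lexle_trans _ _ sorted_order.
Qed.
End RankSort.

(* Integer cells: 1 size m of the sample, 2 number s of points to enclose,
   3 whether a box was found, 4 5 6 the indices of p, q and the top point,
   7 8 loop counters, 9 rank, 10 the sorting permutation, 11 length of the strip
   list, 12 end of the window.  Real cells: 3 the output, 4 5 the sample, 6 7 the
   products dot d x and crs d x, 8 9 d, 10 dot d d, 12 the strip list, 13 the least
   area, 14 the current area. *)
Definition keys_prog : cmd :=
  For 7 (ivar 1)
    (Seq (RSet 6 (ivar 7) (RAdd (RMul (rvar 8) (RGet 4 (ivar 7)))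
                                (RMul (rvar 9) (RGet 5 (ivar 7)))))
         (RSet 7 (ivar 7) (RSub (RMul (rvar 8) (RGet 5 (ivar 7)))
                                (RMul (rvar 9) (RGet 4 (ivar 7)))))).

(** [lexlt] in a language with neither disjunction nor equality. *)
Definition lex_test : bexp :=
  BNot (BAnd (BNot (RLt (RGet 6 (ivar 8)) (RGet 6 (ivar 7))))
             (BNot (BAnd (BNot (RLt (RGet 6 (ivar 7)) (RGet 6 (ivar 8))))
                         (ILt (ivar 8) (ivar 7))))).

Definition rank_prog : cmd :=
  For 7 (ivar 1)
    (Seq (ISet 9 (INum 0) (INum 0))
    (Seq (For 8 (ivar 1)
            (If lex_test (ISet 9 (INum 0) (IAdd (ivar 9) (INum 1))) Skip))
         (ISet 10 (ivar 9) (ivar 7)))).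

Definition strip_prog : cmd :=
  Seq (ISet 11 (INum 0) (INum 0))
  (For 7 (ivar 1)
    (If (BAnd (BNot (RLt (RGet 7 (IGet 10 (ivar 7))) (RGet 7 (ivar 4))))
              (BNot (RLt (RGet 7 (ivar 6)) (RGet 7 (IGet 10 (ivar 7))))))
        (Seq (RSet 12 (ivar 11) (RGet 6 (IGet 10 (ivar 7))))
             (ISet 11 (INum 0) (IAdd (ivar 11) (INum 1))))
        Skip)).

Definition window_end_prog : cmd :=
  Seq (ISet 12 (INum 0) (ISub (IAdd (ivar 7) (ivar 2)) (INum 1)))
      (If (BAnd (ILt (IAdd (ivar 12) (INum 1)) (ivar 11))
                (BNot (RLt (RGet 12 (ivar 12)) (RGet 12 (IAdd (ivar 12) (INum 1))))))
          (ISet 12 (INum 0) (IAdd (ivar 12) (INum 1)))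
          Skip).

Notation width := (RSub (RGet 12 (ivar 12)) (RGet 12 (ivar 7))).
Notation height := (RSub (RGet 7 (ivar 6)) (RGet 7 (ivar 4))).

Definition output_prog : cmd :=
  Seq (RSet 3 (INum 0)
         (RDiv (RSub (RMul (RGet 12 (ivar 7)) (rvar 8))
                     (RMul (RGet 7 (ivar 4)) (rvar 9))) (rvar 10)))
  (Seq (RSet 3 (INum 1)
         (RDiv (RAdd (RMul (RGet 12 (ivar 7)) (rvar 9))
                     (RMul (RGet 7 (ivar 4)) (rvar 8))) (rvar 10)))
  (Seq (RSet 3 (INum 2) (RDiv (RMul width (rvar 8)) (rvar 10)))
  (Seq (RSet 3 (INum 3) (RDiv (RMul width (rvar 9)) (rvar 10)))
  (Seq (RSet 3 (INum 4)
         (RSub (ROfInt (INum 0)) (RDiv (RMul height (rvar 9)) (rvar 10))))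
       (RSet 3 (INum 5) (RDiv (RMul height (rvar 8)) (rvar 10))))))).

Definition record_prog : cmd :=
  Seq (RSet 14 (INum 0) (RDiv (RMul width height) (rvar 10)))
  (If (BNot (BAnd (ILt (INum 0) (ivar 3)) (BNot (RLt (rvar 14) (rvar 13)))))
    (Seq output_prog
    (Seq (ISet 3 (INum 0) (INum 1))
         (RSet 13 (INum 0) (rvar 14))))
    Skip).

Definition windows_prog : cmd :=
  For 7 (ivar 11)
    (If (BAnd (BNot (ILt (ivar 11) (IAdd (ivar 7) (ivar 2))))
              (BNot (BAnd (ILt (INum 0) (ivar 7))
                          (BNot (RLt (RGet 12 (ISub (ivar 7) (INum 1)))
                                     (RGet 12 (ivar 7)))))))
        (Seq window_end_prog record_prog)
        Skip).

Definition tops_prog : cmd := For 6 (ivar 1) (Seq strip_prog windows_prog).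

Definition direction_prog : cmd :=
  Seq (RSet 8 (INum 0) (RSub (RGet 4 (ivar 5)) (RGet 4 (ivar 4))))
  (Seq (RSet 9 (INum 0) (RSub (RGet 5 (ivar 5)) (RGet 5 (ivar 4))))
       (RSet 10 (INum 0) (RAdd (RMul (rvar 8) (rvar 8)) (RMul (rvar 9) (rvar 9))))).

Definition pair_prog : cmd :=
  Seq direction_prog
      (If (RLt (ROfInt (INum 0)) (rvar 10))
          (Seq keys_prog (Seq rank_prog tops_prog))
          Skip).

Definition core_prog : cmd :=
  Seq (ISet 3 (INum 0) (INum 0)) (For 4 (ivar 1) (For 5 (ivar 1) pair_prog)).

(** * Verification of the search program *)

Section Core.
Variables (R : realType) (S : seq (R * R)) (sz : nat).
Hypothesis sz_gt0 : (0 < sz)%N.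
Implicit Types s : store R.
Let m := size S.
Let pt i := nth (0, 0) S i.

Definition data s :=
  [/\ imem s 1 0 = m, imem s 2 0 = sz &
      forall i, (i < m)%N -> rmem s 4 i = (pt i).1 /\ rmem s 5 i = (pt i).2].

Definition direction (d : R * R) s :=
  [/\ rmem s 8 0 = d.1, rmem s 9 0 = d.2 & rmem s 10 0 = dot d d].

Definition keys_ready (d : R * R) s :=
  forall i, (i < m)%N -> rmem s 6 i = dot d (pt i) /\ rmem s 7 i = crs d (pt i).

Definition order_ready (d : R * R) s :=
  forall k, (k < m)%N -> imem s 10 k = nth 0%N (order m (fun i => dot d (pt i))) k.

Lemma wp_keys d s : data s -> direction d s ->
  wp keys_prog (10 * m.+1) (keys_ready d) s.
Proof.
move=> [dm _ dp] [d8 d9 _].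
apply: (@wp_weaken _ _ (m * (3 + 3) + 3) _ (fun s' => forall i, (i < m)%N ->
  rmem s' 6 i = dot d (pt i) /\ rmem s' 7 i = crs d (pt i))) => //; last by lia.
apply: (@wp_for _ _ _ _ _ _ (fun k s' => forall i, (i < k)%N ->
  rmem s' 6 i = dot d (pt i) /\ rmem s' 7 i = crs d (pt i))) => //.
- by move=> s' ss /=; rewrite (ss.1 1%N isT).
move=> k s1 km ss ik Ik; apply: wp_run => //= i; rewrite ltnS leq_eqVlt.
rewrite /upd /= ik (ss.2 8%N isT) (ss.2 9%N isT) (ss.2 4%N isT) (ss.2 5%N isT).
have [e4 e5] := dp _ km; rewrite e4 e5 d8 d9.
by case: eqP => [-> _|_ /= /Ik].
Qed.

Lemma wp_rank d s : data s -> keys_ready d s ->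
  wp rank_prog (20 * m.+1 * m.+1) (order_ready d) s.
Proof.
move=> [dm _ _] kr; pose key i := dot d (pt i).
apply: (@wp_weaken _ _ (m * ((1 + ((m * (3 + 3) + 3) + 1).+1).+1 + 3) + 3) _
  (fun s' => forall i, (i < m)%N -> imem s' 10 (rank m key i) = i)); last first.
- move=> s' h _ k km; rewrite -{1}(rank_order key km) h //.
  by rewrite -(mem_order m key) mem_nth // size_order.
- by nia.
apply: (@wp_for _ _ _ _ _ _ (fun k s' => forall i, (i < k)%N ->
  imem s' 10 (rank m key i) = i)) => //.
- by move=> s' ss /=; rewrite (ss.1 1%N isT).
move=> k s1 km ss ik Ik.
apply: (@wp_seq _ _ _ _ _ (fun s' => imem s' 9 0 = 0%N)); first exact: wp_run.
move=> s2 ss2 e9.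
apply: (@wp_seq _ _ _ _ _ (fun s' => imem s' 9 0 = rank m key k)).
  apply: (@wp_for _ _ _ _ _ _ (fun j s' => imem s' 9 0 = count (lexlt key ^~ k) (iota 0 j))) => //.
  - by move=> s' ss' /=; rewrite (ss'.1 1%N isT) (ss2.1 1%N isT) (ss.1 1%N isT).
  move=> j s3 jm ss3 ij e3; apply: wp_run => //.
  have key6 i : (i < m)%N -> rmem s3 6 i = key i.
    by move=> im; rewrite (ss3.2 6%N isT) (ss2.2 6%N isT) (ss.2 6%N isT); case: (kr _ im).
  have -> : run (If lex_test (ISet 9 (INum 0) (IAdd (ivar 9) (INum 1))) Skip) s3 =
    if lexlt key j k then iupd s3 9 0 (imem s3 9 0 + 1)%N else s3.
    have ik3 : imem s3 7 0 = k by rewrite (ss3.1 7%N isT) (ss2.1 7%N isT).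
    by rewrite /= ij ik3 !key6 // /lexlt negb_and !negbK.
  rewrite -(addn1 j) iotaD count_cat /= add0n addn0 -e3.
  by case: (lexlt key j k); rewrite /= ?addn0.
move=> s3 ss3 e3; apply: wp_run => //= i; rewrite ltnS leq_eqVlt.
rewrite /upd /= e3 (ss3.1 7%N isT) (ss2.1 7%N isT) ik.
rewrite (ss3.1 10%N isT) (ss2.1 10%N isT).
case: (i =P k) => [-> _|nik /= ik']; first by rewrite eqxx.
(* Different indices have different ranks, so earlier entries are not overwritten. *)
case: eqP => [/rank_inj h|_]; last exact: Ik.
by case: nik; apply: h => //; apply: ltn_trans km.
Qed.

Definition strip_ready (B : seq R) s :=
  imem s 11 0 = size B /\ forall k, (k < size B)%N -> rmem s 12 k = B`_k.

Lemma wp_strip ip iq iz s (d := vsub (pt iq) (pt ip)) :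
  (ip < m)%N -> (iz < m)%N -> data s -> keys_ready d s -> order_ready d s ->
  imem s 4 0 = ip -> imem s 6 0 = iz ->
  wp strip_prog (20 * m.+1) (strip_ready (strip_keys S (pt ip) (pt iq) (pt iz))) s.
Proof.
move=> ipm izm [dm _ _] kr orr e4 e6; pose key i := dot d (pt i).
pose O := order m key.
pose F j := [seq key o | o <- take j O &
  crs d (pt ip) <= crs d (pt o) <= crs d (pt iz)].
(* The program filters the list sorted once per direction, the specification sorts the filtered
   list; both are sorted permutations of the same keys. *)
have -> : strip_keys S (pt ip) (pt iq) (pt iz) = F m.
  apply: (sorted_eq le_trans le_anti) (strip_keys_sorted _ _ _ _) _ _.
    by rewrite /F take_oversize ?size_order // sorted_keys.
  rewrite /F take_oversize ?size_order // (permPl (permEl (perm_sort _ _))).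
  rewrite -[S in X in perm_eq X _](mkseq_nth (0, 0)) filter_map -map_comp perm_sym.
  by apply: perm_map; apply: perm_filter; apply: perm_order.
apply: (@wp_weaken _ _ (1 + (m * (5 + 3) + 3)).+1 _ (strip_ready (F m))) => //; last by lia.
apply: (@wp_seq _ _ _ _ _ (fun s' => imem s' 11 0 = 0%N)); first exact: wp_run.
move=> s1 ss1 e11.
apply: (@wp_for _ _ _ _ _ _ (fun j => strip_ready (F j))) => //.
- by move=> s' ss /=; rewrite (ss.1 1%N isT) (ss1.1 1%N isT).
- by rewrite /strip_ready /F take0 e11.
move=> j s2 jm ss2 ij [l2 B2]; apply: wp_run => //.
have Om : (nth 0%N O j < m)%N.
  by rewrite -(mem_order m key) mem_nth // size_order.
have i10 : imem s2 10 j = nth 0%N O j.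
  by rewrite (ss2.1 10%N isT) (ss1.1 10%N isT) orr.
have key2 i : (i < m)%N -> rmem s2 6 i = key i /\ rmem s2 7 i = crs d (pt i).
  move=> im; rewrite (ss2.2 6%N isT) (ss1.2 6%N isT) (ss2.2 7%N isT) (ss1.2 7%N isT).
  exact: kr.
have [k6 k7] := key2 _ Om; have [_ p7] := key2 _ ipm; have [_ z7] := key2 _ izm.
have i4 : imem s2 4 0 = ip by rewrite (ss2.1 4%N isT) (ss1.1 4%N isT).
have i6 : imem s2 6 0 = iz by rewrite (ss2.1 6%N isT) (ss1.1 6%N isT).
rewrite /F (take_nth 0%N) ?size_order // filter_rcons /= ij i10 i4 i6 k6 k7 p7 z7.
rewrite -!leNgt -/O; case: ifP => _ //; rewrite map_rcons.
split=> /=.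
  by rewrite size_rcons l2 addn1.
move=> k; rewrite size_rcons ltnS nth_rcons leq_eqVlt /upd /= l2 -/(F j).
by case: eqP => [->|_ /= kF]; rewrite ?ltnn ?eqxx // kF B2.
Qed.

(** Invariant of the whole search, with [C] the candidates scanned so far. The flag replaces an
    infinite initial value of the least area. *)
Definition best (C : seq (slab R)) s :=
  if imem s 3 0 == 0%N then C = [::] else
  exists2 t, t \in C & [/\ output s = box t, rmem s 13 0 = slab_area t &
    forall t', t' \in C -> slab_area t <= slab_area t'].

Lemma best_same C s s' :
  imem s' 3 = imem s 3 -> rmem s' 3 = rmem s 3 -> rmem s' 13 = rmem s 13 ->
  best C s -> best C s'.
Proof. by rewrite /best /output => -> -> ->. Qed.

Lemma wp_window_end B s i : (0 < size B)%N -> data s -> strip_ready B s ->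
  (i + sz <= size B)%N ->
  imem s 7 0 = i -> wp window_end_prog 5 (fun s' => imem s' 12 0 = win_end sz B i) s.
Proof.
move=> B0 [_ e2 _] [e11 eB] le e7; apply: wp_run => //.
rewrite /= /upd /= e7 e2 e11 !addn1 /win_end.
set j := (i + sz - 1)%N; case: (ltnP j.+1 (size B)) => h /=; last by [].
by rewrite !eB //; [case: ifP => _; rewrite /= | rewrite ltnW].
Qed.

Lemma wp_rset3 k e s s0 (v : R) :
  imem s = imem s0 -> (forall a, a != 3%N -> rmem s a = rmem s0 a) ->
  reval s e = v ->
  wp (RSet 3 (INum k) e) 1 (fun s' => [/\ imem s' = imem s0,
    forall a, a != 3%N -> rmem s' a = rmem s0 a &
    forall j, rmem s' 3 j = if j == k then v else rmem s 3 j]) s.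
Proof.
move=> ei er ev; apply: wp_run => //=; split=> //.
  move=> a a3; rewrite -er //; apply/funext => j.
  by rewrite /upd (negPf a3).
by move=> j; rewrite /upd /= ev.
Qed.

Lemma wp_output s (d : R * R) (a b c e : R) :
  rmem s 12 (imem s 7 0) = a -> rmem s 12 (imem s 12 0) = b ->
  rmem s 7 (imem s 4 0) = c -> rmem s 7 (imem s 6 0) = e -> direction d s ->
  wp output_prog 11 (fun s' => output s' = box (d, a, b, c, e)) s.
Proof.
move=> ea eb ec ee [e8 e9 e10].
apply: (@wp_seq _ _ _ 1 9); first exact: (@wp_rset3 _ _ s s) erefl (fun _ _ => erefl) erefl.
move=> s1 _ [i1 r1 o1].
apply: (@wp_seq _ _ _ 1 7); first exact: (@wp_rset3 _ _ s1 s) erefl.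
move=> s2 _ [i2 r2 o2].
apply: (@wp_seq _ _ _ 1 5); first exact: (@wp_rset3 _ _ s2 s) erefl.
move=> s3 _ [i3 r3 o3].
apply: (@wp_seq _ _ _ 1 3); first exact: (@wp_rset3 _ _ s3 s) erefl.
move=> s4 _ [i4 r4 o4].
apply: (@wp_seq _ _ _ 1 1); first exact: (@wp_rset3 _ _ s4 s) erefl.
move=> s5 _ [i5 r5 o5].
apply: wp_weaken; [exact: (@wp_rset3 _ _ s5 s) erefl | by [] |].
move=> s6 [i6 r6 o6] _; rewrite /output !(o6, o5, o4, o3, o2, o1) /=.
rewrite !(i1, i2, i3, i4, i5) !(r1, r2, r3, r4, r5) //.
by rewrite ea eb ec ee e8 e9 e10 sub0r.
Qed.

Lemma wp_record C B s i j p q z (d := vsub q p) (t := (d, B`_i, B`_j, crs d p, crs d z)) :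
  (i < size B)%N -> (j < size B)%N -> strip_ready B s -> direction d s ->
  imem s 7 0 = i -> imem s 12 0 = j ->
  rmem s 7 (imem s 4 0) = crs d p -> rmem s 7 (imem s 6 0) = crs d z ->
  best C s -> wp record_prog 25 (best (rcons C t)) s.
Proof.
move=> iB jB [_ eB] [e8 e9 e10] e7 e12 ep ez bC.
apply: (@wp_weaken _ _ (1 + (11 + 3).+2).+1 _ (best (rcons C t))) => //.
apply: (@wp_seq _ _ _ _ _ (fun s' => rmem s' 14 0 = slab_area t)).
  by apply: wp_run => //=; rewrite /upd /= e7 e12 !eB // ep ez e10.
move=> s1 ss1 e14; have {}bC : best C s1.
  by apply: best_same bC; [apply: ss1.1|apply: ss1.2|apply: ss1.2].
apply: wp_if => /= h; last first.
  apply: wp_run => //=; move: h bC; rewrite negbK => /andP[]; rewrite lt0n -leNgt /best.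
  move=> /negPf -> le [t' tC [out e13 tmin]]; exists t'; first by rewrite mem_rcons inE tC orbT.
  split=> // t''; rewrite mem_rcons inE => /predU1P[->|/tmin //].
  by rewrite -e14 -e13.
apply: (@wp_seq _ _ _ _ _ (fun s' => output s' = box t)).
  apply: wp_output; rewrite ?(ss1.1 7%N isT) ?(ss1.1 12%N isT) ?(ss1.2 12%N isT)
    ?(ss1.2 7%N isT) ?(ss1.1 4%N isT) ?(ss1.1 6%N isT) ?e7 ?e12 ?eB //.
  by rewrite /direction (ss1.2 8%N isT) (ss1.2 9%N isT) (ss1.2 10%N isT).
move=> s2 ss2 out; have e14' : rmem s2 14 0 = slab_area t by rewrite (ss2.2 14%N isT).
apply: wp_run => //; rewrite /best /= {1}/upd /=; exists t.
  by rewrite mem_rcons mem_head.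
split=> //.
move=> t'; rewrite mem_rcons inE => /predU1P[->//|t'C].
move: h bC; rewrite /best lt0n negb_and !negbK => /orP[/eqP e3|lt].
  by rewrite e3 /= => C0; rewrite C0 in t'C.
case: ifP => [_ C0|_ [t0 _ [_ e13 tmin]]]; first by rewrite C0 in t'C.
by apply: le_trans (tmin _ t'C); rewrite -e14 -e13 ltW.
Qed.

Lemma wp_windows C ip iq iz s (d := vsub (pt iq) (pt ip))
    (B := strip_keys S (pt ip) (pt iq) (pt iz)) :
  (ip < m)%N -> (iz < m)%N -> data s -> keys_ready d s -> strip_ready B s ->
  direction d s -> imem s 4 0 = ip -> imem s 6 0 = iz -> best C s ->
  wp windows_prog (50 * m.+1) (best (C ++ cands3 S sz (pt ip) (pt iq) (pt iz))) s.
Proof.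
move=> ipm izm ds kr sr dr e4 e6 bC.
have Bm : (size B <= m)%N.
  by rewrite size_sort size_map size_filter count_size.
pose mk i := (d, B`_i, B`_(win_end sz B i), crs d (pt ip), crs d (pt iz)).
have -> : cands3 S sz (pt ip) (pt iq) (pt iz) =
    [seq mk i | i <- iota 0 (size B) & win_start sz B i].
  by rewrite /cands3 /windows -map_comp.
apply: (@wp_weaken _ _ (size B * ((5 + 25).+1.+1 + 3) + 3) _
  (best (C ++ [seq mk i | i <- iota 0 (size B) & win_start sz B i]))) => //; last by nia.
apply: (@wp_for _ _ _ _ _ _
  (fun j => best (C ++ [seq mk i | i <- iota 0 j & win_start sz B i]))) => //.
- by move=> s' ss /=; rewrite (ss.1 11%N isT); case: sr.
- by rewrite cats0.
move=> j s1 jB ss1 ij b1.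
have ds1 : data s1.
  by rewrite /data (ss1.1 1%N isT) (ss1.1 2%N isT) (ss1.2 4%N isT) (ss1.2 5%N isT).
have sr1 : strip_ready B s1 by rewrite /strip_ready (ss1.1 11%N isT) (ss1.2 12%N isT).
have dr1 : direction d s1.
  by rewrite /direction (ss1.2 8%N isT) (ss1.2 9%N isT) (ss1.2 10%N isT).
have test : beval s1 (BAnd (BNot (ILt (ivar 11) (IAdd (ivar 7) (ivar 2))))
              (BNot (BAnd (ILt (INum 0) (ivar 7))
                          (BNot (RLt (RGet 12 (ISub (ivar 7) (INum 1)))
                                     (RGet 12 (ivar 7))))))) = win_start sz B j.
  have [_ e2 _] := ds1; have [e11 eB] := sr1.
  by rewrite /= ij e2 e11 !eB // ?subn1 // (leq_ltn_trans (leq_pred _)).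
rewrite -(addn1 j) iotaD filter_cat map_cat catA /= add0n.
apply: wp_if; rewrite test => h; last first.
  by rewrite (negPf h) cats0; apply: wp_run.
rewrite h /= cats1; have jsz : (j + sz <= size B)%N by move: h; rewrite /win_start -leqNgt => /andP[].
apply: (@wp_seq _ _ _ _ _ (fun s' => imem s' 12 0 = win_end sz B j)).
  by apply: wp_window_end => //; apply: leq_ltn_trans jB.
move=> s2 ss2 e12.
apply: (@wp_record _ B) => //.
- rewrite /win_end; case: ifP => [/andP[]//|_].
  by rewrite subn1 prednK ?addn_gt0 ?sz_gt0 ?orbT.
- by rewrite /strip_ready (ss2.1 11%N isT) (ss2.2 12%N isT).
- by rewrite /direction (ss2.2 8%N isT) (ss2.2 9%N isT) (ss2.2 10%N isT).
- by rewrite (ss2.1 7%N isT).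
- by rewrite (ss2.1 4%N isT) (ss2.2 7%N isT) (ss1.1 4%N isT) (ss1.2 7%N isT) e4; case: (kr _ ipm).
- by rewrite (ss2.1 6%N isT) (ss2.2 7%N isT) (ss1.1 6%N isT) (ss1.2 7%N isT) e6; case: (kr _ izm).
- by apply: best_same b1; [apply: ss2.1|apply: ss2.2|apply: ss2.2].
Qed.

Lemma take_S_rcons j : (j < m)%N -> take j.+1 S = rcons (take j S) (pt j).
Proof. exact: take_nth. Qed.

Lemma wp_tops C ip iq s (d := vsub (pt iq) (pt ip)) :
  (ip < m)%N -> data s -> keys_ready d s -> order_ready d s ->
  direction d s -> imem s 4 0 = ip -> best C s ->
  wp tops_prog (100 * m.+1 * m.+1)
     (best (C ++ flatten [seq cands3 S sz (pt ip) (pt iq) z | z <- S])) s.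
Proof.
move=> ipm ds kr orr dr e4 bC.
pose F j := C ++ flatten [seq cands3 S sz (pt ip) (pt iq) z | z <- take j S].
apply: (@wp_weaken _ _ (m * ((20 * m.+1 + 50 * m.+1).+1 + 3) + 3) _ (best (F m))).
- apply: (@wp_for _ _ _ _ _ _ (fun j => best (F j))) => //.
  + by move=> s' ss /=; rewrite (ss.1 1%N isT); case: ds.
  + by rewrite /F take0 cats0.
  move=> j s1 jm ss1 ij b1.
  have ds1 : data s1.
    by rewrite /data (ss1.1 1%N isT) (ss1.1 2%N isT) (ss1.2 4%N isT) (ss1.2 5%N isT).
  have e41 : imem s1 4 0 = ip by rewrite (ss1.1 4%N isT).
  apply: wp_seq.
    apply: (@wp_strip ip iq j) => //.
    + by rewrite /keys_ready (ss1.2 6%N isT) (ss1.2 7%N isT).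
    + by rewrite /order_ready (ss1.1 10%N isT).
  move=> s2 ss2 sr2; rewrite /F take_S_rcons // map_rcons flatten_rcons catA.
  apply: wp_windows => //.
  + by rewrite /data (ss2.1 1%N isT) (ss2.1 2%N isT) (ss2.2 4%N isT) (ss2.2 5%N isT).
  + by rewrite /keys_ready (ss2.2 6%N isT) (ss2.2 7%N isT) (ss1.2 6%N isT) (ss1.2 7%N isT).
  + by rewrite /direction (ss2.2 8%N isT) (ss2.2 9%N isT) (ss2.2 10%N isT)
      (ss1.2 8%N isT) (ss1.2 9%N isT) (ss1.2 10%N isT).
  + by rewrite (ss2.1 4%N isT).
  + by rewrite (ss2.1 6%N isT).
  + by apply: best_same b1; [apply: ss2.1|apply: ss2.2|apply: ss2.2].
- by nia.
- by move=> s'; rewrite /F take_size.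
Qed.

Lemma wp_pair C ip iq s :
  (ip < m)%N -> (iq < m)%N -> data s -> imem s 4 0 = ip -> imem s 5 0 = iq ->
  best C s ->
  wp pair_prog (200 * m.+1 * m.+1) (best (C ++ cands2 S sz (pt ip) (pt iq))) s.
Proof.
move=> ipm iqm ds e4 e5 bC; set d := vsub (pt iq) (pt ip).
have [dm d2 dp] := ds.
have [p4 p5] := dp _ ipm; have [q4 q5] := dp _ iqm.
apply: (@wp_weaken _ _ (5 + (10 * m.+1 + (20 * m.+1 * m.+1 + 100 * m.+1 * m.+1).+1).+2).+1 _
   (best (C ++ cands2 S sz (pt ip) (pt iq)))) => //; last by nia.
apply: (@wp_seq _ _ _ _ _ (direction d)).
  by apply: wp_run => //=; rewrite /direction /= /upd /= e4 e5 p4 p5 q4 q5.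
move=> s1 ss1 dr1; have [_ _ e10] := dr1.
have ds1 : data s1.
  by rewrite /data (ss1.1 1%N isT) (ss1.1 2%N isT) (ss1.2 4%N isT) (ss1.2 5%N isT).
have b1 : best C s1 by apply: best_same bC; [apply: ss1.1|apply: ss1.2|apply: ss1.2].
apply: wp_if => /=; rewrite e10 dot_gt0 vsub_neq0 /cands2 => h; last first.
  rewrite negbK in h; rewrite h cats0; apply: wp_run => //.
rewrite (negPf h); apply: wp_seq; first exact: wp_keys dr1.
move=> s2 ss2 kr2; have ds2 : data s2.
  by rewrite /data (ss2.1 1%N isT) (ss2.1 2%N isT) (ss2.2 4%N isT) (ss2.2 5%N isT).
apply: wp_seq; first exact: wp_rank kr2.
move=> s3 ss3 or3; apply: wp_tops => //.
- by rewrite /data (ss3.1 1%N isT) (ss3.1 2%N isT) (ss3.2 4%N isT) (ss3.2 5%N isT).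
- by rewrite /keys_ready (ss3.2 6%N isT) (ss3.2 7%N isT).
- by rewrite /direction (ss3.2 8%N isT) (ss3.2 9%N isT) (ss3.2 10%N isT)
     (ss2.2 8%N isT) (ss2.2 9%N isT) (ss2.2 10%N isT).
- by rewrite (ss3.1 4%N isT) (ss2.1 4%N isT) (ss1.1 4%N isT).
- apply: (@best_same _ s2); [exact: ss3.1|exact: ss3.2|exact: ss3.2|].
  by apply: best_same b1; [apply: ss2.1|apply: ss2.2|apply: ss2.2].
Qed.

Lemma wp_core s : data s ->
  wp core_prog (300 * m.+1 ^ 4) (best (cands S sz)) s.
Proof.
move=> ds; pose F j := flatten [seq cands1 S sz p | p <- take j S].
apply: (@wp_weaken _ _
  (1 + (m * (m * (200 * m.+1 * m.+1 + 3) + 3 + 3) + 3)).+1 _ (best (F m))); last first.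
- by move=> s'; rewrite /F take_size.
- rewrite !expnS expn0 muln1; nia.
apply: (@wp_seq _ _ _ _ _ (fun s' => imem s' 3 0 = 0%N)); first exact: wp_run.
move=> s1 ss1 e3.
have ds1 : data s1.
  by rewrite /data (ss1.1 1%N isT) (ss1.1 2%N isT) (ss1.2 4%N isT) (ss1.2 5%N isT).
apply: (@wp_for _ _ _ _ _ _ (fun j => best (F j))) => //.
- by move=> s' ss /=; rewrite (ss.1 1%N isT); case: ds1.
- by rewrite /F take0 /best e3.
move=> ip s2 ipm ss2 e4 b2.
have ds2 : data s2.
  by rewrite /data (ss2.1 1%N isT) (ss2.1 2%N isT) (ss2.2 4%N isT) (ss2.2 5%N isT).
pose G j := F ip ++ flatten [seq cands2 S sz (pt ip) q | q <- take j S].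
apply: (@wp_weaken _ _ (m * (200 * m.+1 * m.+1 + 3) + 3) _ (best (G m))) => //; last first.
  by move=> s'; rewrite /G take_size /F take_S_rcons // map_rcons flatten_rcons.
apply: (@wp_for _ _ _ _ _ _ (fun j => best (G j))) => //.
- by move=> s' ss /=; rewrite (ss.1 1%N isT); case: ds2.
- by rewrite /G take0 cats0.
move=> iq s3 iqm ss3 e5 b3.
rewrite /G take_S_rcons // map_rcons flatten_rcons catA.
apply: wp_pair => //.
  by rewrite /data (ss3.1 1%N isT) (ss3.1 2%N isT) (ss3.2 4%N isT) (ss3.2 5%N isT).
by rewrite (ss3.1 4%N isT).
Qed.

End Core.

(** * Correctness *)

Section Correctness.
Variable R : realType.
Implicit Types (X S : seq (R * R)) (t k : nat) (eps : R) (s : store R).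

Definition good X t eps (r : rect R) :=
  [/\ is_rect r, area r <= opt X t &
      ((size X)%:R - t%:R) * (1 - eps) <= (enclosed r X)%:R
        <= (size X)%:R - t%:R + (1 : R)].

(** Makes the set in [opt] nonempty, so that [inf] is a genuine infimum, and provides a first
    rectangle from which a candidate is obtained. *)
Lemma cover_all X : X != [::] -> exists2 r, is_rect r & enclosed r X = size X.
Proof.
move=> X0.
have [a [b [c [e [[aX bX cX eX] hd hc]]]]] := exists_extremal (1, 0) X0.
set sl : slab R := ((1, 0), dot (1, 0) a, dot (1, 0) b, crs (1, 0) c, crs (1, 0) e).
have pr : proper_slab sl.
  apply/and3P; split; first by rewrite xpair_eqE oner_eq0.
    by case/andP: (hd _ bX).
  by case/andP: (hc _ eX).
exists (box sl); first exact: is_rect_box.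
rewrite enclosed_box // (@eq_in_count _ _ predT) ?count_predT //.
by move=> x xX; apply/andP; split; [exact: hd | exact: hc].
Qed.

Lemma le_opt X t (v : R) : X != [::] ->
  (forall r, is_rect r -> (size X - t <= enclosed r X)%N -> v <= area r) ->
  v <= opt X t.
Proof.
move=> X0 H; apply: lb_le_inf; last by move=> _ [r [rr cnt] <-]; exact: H.
have [r rr cnt] := cover_all X0.
by exists (area r), r => //; split; rewrite // cnt leq_subr.
Qed.

Lemma distinct_in_filter (T : eqType) (P : pred T) (A : seq T) :
  uniq A -> (2 <= count P A)%N ->
  exists x y, [/\ x \in A, y \in A, P x, P y & x != y].
Proof.
rewrite -size_filter => /(filter_uniq P).
have sub x : x \in filter P A -> P x /\ x \in A by rewrite mem_filter => /andP[].
case: (filter P A) sub => // x [//|y B] sub /= /andP[]; rewrite inE negb_or => /andP[xy _] _ _.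
have [Px xA] := sub x (mem_head _ _).
have [|Py yA] := sub y; first by rewrite !inE eqxx orbT.
by exists x, y.
Qed.

Lemma best_nonempty (C : seq (slab R)) s (t0 : slab R) : best C s -> t0 \in C ->
  exists2 c, c \in C & output s = box c /\
    forall c', c' \in C -> slab_area c <= slab_area c'.
Proof.
rewrite /best; case: ifP => [_ -> //|_ [t tC [out _ tmin]] _].
by exists t.
Qed.

Lemma cands_of_rect X t r : uniq X -> (2 * t < size X)%N -> (4 <= size X)%N ->
  is_rect r -> (size X - t <= enclosed r X)%N ->
  exists2 c, c \in cands X (size X - t) & slab_area c <= area r.
Proof.
move=> uX tX X4 rr cnt; apply: cands_minimal => //; first by lia.
have [|x [y [xX yX /asboolP hx /asboolP hy xy]]] :=
  @distinct_in_filter _ (fun x => `[< in_rect r x >]) X uX.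
  by apply: leq_trans cnt; lia.
by exists x, y.
Qed.

(** The upper bound [n - t + 1] is the closed count [s + 1] of a window, the extra point coming from
    a tie on a lateral side. *)
Lemma good_exact X t eps s : uniq X -> no_three_collinear X ->
  (2 * t < size X)%N -> (4 <= size X)%N -> 0 < eps < 1 ->
  best (cands X (size X - t)) s -> good X t eps (output s).
Proof.
move=> uX nX tX X4 /andP[e0 e1] bs.
have X0 : X != [::] by case: (X) X4.
have s0 : (0 < size X - t)%N by lia.
have [r0 rr0 cnt0] := cover_all X0.
have [|c0 c0C _] := @cands_of_rect X t r0 uX tX X4 rr0.
  by rewrite cnt0 leq_subr.
have [c cC [-> cmin]] := best_nonempty bs c0C.
have [_ [_ [_ [_ [_ [_ _ pc cnt _]]]]]] := cands_sound s0 cC.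
have cnt' := cands_count_le s0 uX nX cC.
split; first exact: is_rect_box.
  rewrite area_box //; apply: le_opt => // r rr cr.
  have [c1 c1C] := cands_of_rect uX tX X4 rr cr.
  by apply: le_trans; apply: cmin.
have eX : (size X)%:R - t%:R = (size X - t)%:R :> R by rewrite natrB //; lia.
rewrite enclosed_box // eX natr1 !ler_nat cnt' andbT.
apply: (@le_trans _ _ (size X - t)%:R); last by rewrite ler_nat.
by rewrite ler_piMr ?ler0n //; lra.
Qed.

Definition in_range (b : bool) (c : slab R) : pred (R * R) :=
  if b then in_slab c else in_open_slab c.

(* Applied to an open box, the slack 2 in t + 2 makes room for the points on the
   lateral sides of the closed box, of which there are at most 4. *)
Definition faithful X t eps S k := forall b p q z x y,
  p \in X -> q \in X -> z \in X -> x \in X -> y \in X ->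
  let out := predC (in_range b (cand_of p q z x y)) in
  ((count out X <= t + 2)%N -> (count out S <= k)%N) /\
  (t%:R + 3 / 8 * eps * (size X)%:R <= (count out X)%:R -> (k < count out S)%N).

Lemma good_sample X t eps S k s : uniq X -> no_three_collinear X ->
  (2 * t < size X)%N -> 0 < eps < 1 -> 16 <= eps * (size X)%:R ->
  {subset S <= X} -> (k < size S)%N -> faithful X t eps S k ->
  best (cands S (size S - k)) s -> good X t eps (output s).
Proof.
move=> uX nX tX /andP[e0 e1] big SX kS fa bs.
have s0 : (0 < size S - k)%N by lia.
have n16 : 16 < (size X)%:R :> R by nra.
have X4 : (4 <= size X)%N by move: n16; rewrite ltr_nat; lia.
have X0 : X != [::] by case: (X) X4.
have tXR : 2 * t%:R + 1 <= (size X)%:R :> R by rewrite -natrM natr1 ler_nat.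
have countC (P : pred (R * R)) (A : seq (R * R)) : (count P A + count (predC P) A = size A)%N.
  exact: count_predC.
(* Repeated draws might make all enclosed sample points coincide. But a degenerate box holding only
   [x] misses [n - 1] points of [X], at least [t + 3 eps n / 8], so by faithfulness [x] occurs fewer
   than [size S - k] times in [S]. *)
have two r : is_rect r -> (size S - k <= enclosed r S)%N ->
    exists x y, [/\ x \in S, y \in S, in_rect r x, in_rect r y & x != y].
  move=> rr cnt; apply: contrapT => no.
  have : has (fun x => `[< in_rect r x >]) S by rewrite has_count (leq_trans s0).
  move=> /hasP[x xS /asboolP xr].
  have [y [yX xy]] : exists y, y \in X /\ x != y.
    case: (X) uX X4 => [|y1 [|y2 Y]] //= /andP[]; rewrite inE negb_or => /andP[y12 _] _ _.
    case: (eqVneq x y1) => [->|n1]; last by exists y1; rewrite mem_head.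
    by exists y2; rewrite !inE eqxx orbT.
  have xX := SX _ xS.
  have single v : in_range true (cand_of x y x x x) v -> v = x.
    move=> /andP[/andP[h1 h2] /andP[h3 h4]].
    have d0 : 0 < dot (vsub y x) (vsub y x) by rewrite dot_gt0 vsub_neq0.
    have ed : dot (vsub y x) (vsub v x) = 0.
      by move: h1 h2; rewrite /dot /vsub /=; lra.
    have ec : crs (vsub y x) (vsub v x) = 0.
      by move: h3 h4; rewrite /crs /vsub /=; lra.
    set d := vsub y x in d0 ed ec; set u := vsub v x in ed ec.
    have e1' : dot d d * u.1 = d.1 * dot d u - d.2 * crs d u by rewrite /dot /crs; ring.
    have e2' : dot d d * u.2 = d.2 * dot d u + d.1 * crs d u by rewrite /dot /crs; ring.
    move: e1' e2'; rewrite ed ec !mulr0 subr0 addr0 => /eqP + /eqP.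
    rewrite !mulf_eq0 gt_eqF //= /u /vsub /= !subr_eq0 => /eqP h5 /eqP h6.
    by case: (v) h5 h6 => ? ? /= -> ->; case: (x).
  have [_ /(_ _)] := fa true x y x x x xX yX xX xX xX.
  have cX : (count (in_range true (cand_of x y x x x)) X <= 1)%N.
    apply: (@leq_trans (count_mem x X)); last by rewrite count_uniq_mem // leq_b1.
    by apply: sub_count => v /single -> /=; rewrite eqxx.
  have := countC (in_range true (cand_of x y x x x)) X.
  have := countC (in_range true (cand_of x y x x x)) S.
  set oS := count (predC _) S; set oX := count (predC _) X => eS eX hyp.
  have : (k < oS)%N.
    apply: hyp; have : (size X)%:R - 1 <= oX%:R :> R.
      by rewrite lerBlDr natr1 ler_nat -eX -addn1 addnC leq_add2l.
    by clear -n16 tXR e0 e1; nra.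
  suff cS : (size S - k <= count (in_range true (cand_of x y x x x)) S)%N.
    by move=> kO; clear -eS cS kO kS; lia.
  apply: leq_trans cnt _; apply: sub_in_count => v vS /asboolP vr.
  have <- : x = v.
    by apply/eqP; apply: contrapT => /negP xv; apply: no; exists x, v.
  by rewrite /in_range /in_slab /cand_of !lexx.
(* Faithfulness does not speak of [r]. The candidate [c0] of [X] below it does belong to the family,
   hence encloses enough of [S] to compete in the search on [S]. *)
have key r : is_rect r -> (size X - t <= enclosed r X)%N ->
    exists2 c, c \in cands S (size S - k) & slab_area c <= area r.
  move=> rr cnt; have [c0 c0C le0] := cands_of_rect uX tX X4 rr cnt.
  have sX0 : (0 < size X - t)%N by clear -tX; lia.
  have [p [q [z [x [y [[pX qX zX xX yX] ec pc cnt0 _]]]]]] := cands_sound sX0 c0C.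
  have [/(_ _) hA _] := fa true p q z x y pX qX zX xX yX.
  rewrite -ec /in_range in hA.
  have eX := countC (in_slab c0) X; have eS := countC (in_slab c0) S.
  have cntS : (size S - k <= count (in_slab c0) S)%N.
    have : (count (predC (in_slab c0)) S <= k)%N by apply: hA; clear -eX cnt0 tX; lia.
    by clear -eS; lia.
  rewrite -(enclosed_box _ pc) in cntS.
  have [c1 c1C le1] := cands_minimal s0 (is_rect_box c0) cntS (two _ (is_rect_box c0) cntS).
  by exists c1 => //; rewrite area_box // in le1; apply: le_trans le1 le0.
have [r0 rr0 cnt0] := cover_all X0.
have [|c0 c0C _] := key _ rr0; first by rewrite cnt0 leq_subr.
have [c cC [-> cmin]] := best_nonempty bs c0C.
have [p [q [z [x [y [[pS qS zS xS yS] ec pc cnt cnt']]]]]] := cands_sound s0 cC.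
split; first exact: is_rect_box.
  rewrite area_box //; apply: le_opt => // r rr cr.
  have [c1 c1C] := key r rr cr.
  by apply: le_trans; apply: cmin.
rewrite enclosed_box //.
have [_ hB] := fa true p q z x y (SX _ pS) (SX _ qS) (SX _ zS) (SX _ xS) (SX _ yS).
have [hA _] := fa false p q z x y (SX _ pS) (SX _ qS) (SX _ zS) (SX _ xS) (SX _ yS).
rewrite -ec /in_range in hA hB.
have eX := countC (in_slab c) X; have eS := countC (in_slab c) S.
have eX' := countC (in_open_slab c) X; have eS' := countC (in_open_slab c) S.
have co := in_slab_count_open uX nX pc.
apply/andP; split.
  have eXR : (count (in_slab c) X)%:R = (size X)%:R - (count (predC (in_slab c)) X)%:R :> R.
    by rewrite -eX natrD addrK.
  (* Missing [t + 3 eps n / 8] points of [X] would mean missing more than [k] points of [S].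
     Otherwise [n - t > n / 2] gives [3 eps n / 8 < eps (n - t)]. *)
  rewrite eXR; case: (leP (t%:R + 3 / 8 * eps * (size X)%:R) (count (predC (in_slab c)) X)%:R) => h.
    by have := hB h; clear -eS cnt kS; lia.
  by clear -h n16 tXR e0 e1; nra.
(* The open box holds fewer than [size S - k] sample points, so it misses at least [t + 3] points of
   [X]; at most four lateral points come back, and [n - t - 3 + 4 = n - t + 1]. *)
have : (count (predC (in_open_slab c)) X > t + 2)%N.
  by rewrite ltnNge; apply/negP => /hA; clear -eS' cnt' kS; lia.
move=> h; have : (count (in_slab c) X + t <= size X + 1)%N by clear -h co eX'; lia.
by rewrite -(ler_nat R) !natrD; lra.
Qed.

End Correctness.

(** * Sampling *)

Notation n_in := (IGet 0 (INum 0)).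
Notation t_in := (IGet 0 (INum 1)).
Notation eps_in := (RGet 2 (INum 0)).

(* Integer cells: 13 the binary logarithm of n, 14 a power of two, 15 a random
   index, 16 the threshold k. *)
Definition copy_point (i v : iexp) : cmd := Seq (RSet 4 i (RGet 0 v)) (RSet 5 i (RGet 1 v)).

Definition exact_prog : cmd :=
  Seq (For 7 n_in (copy_point (ivar 7) (ivar 7)))
  (Seq (ISet 1 (INum 0) n_in) (ISet 2 (INum 0) (ISub n_in t_in))).

Definition log_prog : cmd :=
  Seq (ISet 13 (INum 0) (INum 0)) (Seq (ISet 14 (INum 0) (INum 1))
  (While (ILt (ivar 14) n_in)
    (Seq (ISet 14 (INum 0) (IAdd (ivar 14) (ivar 14)))
         (ISet 13 (INum 0) (IAdd (ivar 13) (INum 1)))))).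

Definition outlier_weight : rexp := RAdd (ROfInt t_in) (RMul eps_in (ROfInt n_in)).

Definition size_prog : cmd :=
  Seq (ISet 1 (INum 0) (INum 0))
  (While (RLt (RMul (ROfInt (ivar 1)) (RMul (RMul eps_in eps_in) (ROfInt n_in)))
              (RMul (RMul (RMul (ROfInt (INum 64)) (ROfInt (INum 64))) (ROfInt (ivar 13)))
                    outlier_weight))
    (ISet 1 (INum 0) (IAdd (ivar 1) (INum 1)))).

(** Computes [k] as the floor of [m (t / n + eps / 4)], with the comparison multiplied by [4 n]. *)
Definition threshold_prog : cmd :=
  Seq (ISet 16 (INum 0) (INum 0))
  (Seq (While (BNot (RLt
         (RMul (ROfInt (ivar 1)) (RAdd (RMul (ROfInt (INum 4)) (ROfInt t_in))
                                       (RMul eps_in (ROfInt n_in))))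
         (RMul (ROfInt (IAdd (ivar 16) (INum 1))) (RMul (ROfInt (INum 4)) (ROfInt n_in)))))
       (ISet 16 (INum 0) (IAdd (ivar 16) (INum 1))))
  (ISet 2 (INum 0) (ISub (ivar 1) (ivar 16)))).

Definition draw_body : cmd :=
  Seq (IRand 15 (INum 0) (ISub n_in (INum 1))) (copy_point (ivar 7) (ivar 15)).

Definition draw_prog : cmd := For 7 (ivar 1) draw_body.

Definition main_prog : cmd :=
  Seq (If (RLt (RMul eps_in (ROfInt n_in)) (ROfInt (INum 16)))
          exact_prog
          (Seq log_prog (Seq size_prog (Seq threshold_prog draw_prog))))
      core_prog.

Section Main.
Variables (R : realType) (X : seq (R * R)) (t : nat) (eps : R).
Let n := size X.
Let s0 := input X t eps.
Implicit Types (s : store R) (w : seq nat).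

Definition input_kept s := imem s 0 = imem s0 0 /\ forall a, (a <= 2)%N -> rmem s a = rmem s0 a.

Lemma input_n s : input_kept s -> imem s 0 0 = n. Proof. by case=> ->. Qed.
Lemma input_t s : input_kept s -> imem s 0 1 = t. Proof. by case=> ->. Qed.
Lemma input_eps s : input_kept s -> rmem s 2 0 = eps. Proof. by case=> _ ->. Qed.
Lemma input_x s i : input_kept s -> rmem s 0 i = (nth (0, 0) X i).1.
Proof. by case=> _ ->. Qed.
Lemma input_y s i : input_kept s -> rmem s 1 i = (nth (0, 0) X i).2.
Proof. by case=> _ ->. Qed.

Lemma same_input p s s' : 0%N \notin iwrites p -> all (leq 3) (rwrites p) ->
  same p s s' -> input_kept s -> input_kept s'.
Proof.
move=> i0 /allP r0 [h1 h2] [k1 k2]; split; first by rewrite h1.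
move=> a a2; rewrite h2 ?k2 //; apply/negP => /r0; lia.
Qed.

Lemma wp_exact s : input_kept s ->
  wp exact_prog (10 * n.+1) (data X (n - t)) s.
Proof.
move=> ki; apply: (@wp_weaken _ _ ((n * (3 + 3) + 3) + 3).+1 _ (data X (n - t))) => //; last by lia.
apply: (@wp_seq _ _ _ _ _ (fun s' => forall i, (i < n)%N ->
   rmem s' 4 i = (nth (0, 0) X i).1 /\ rmem s' 5 i = (nth (0, 0) X i).2)).
  apply: (@wp_for _ _ _ _ _ _ (fun k s' => forall i, (i < k)%N ->
   rmem s' 4 i = (nth (0, 0) X i).1 /\ rmem s' 5 i = (nth (0, 0) X i).2)) => //.
    by move=> s' ss /=; rewrite (ss.1 0%N isT) (input_n ki).
  move=> k s1 kn ss ik Ik; have ki1 : input_kept s1 by apply: same_input ss ki.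
  apply: wp_run => //= i; rewrite ltnS leq_eqVlt /upd /= ik.
  by rewrite !input_x // !input_y //; case: eqP => [->|_ /= /Ik].
move=> s1 ss1 h; have ki1 : input_kept s1 by apply: same_input ss1 ki.
apply: wp_run => //; split=> //=; rewrite /upd /= ?(input_n ki1) ?(input_t ki1) //.
Qed.

(** The number of rounds is bounded crudely by [n], from [j < 2 ^ j < n]; linear time is available
    anyway. *)
Lemma wp_log s : (0 < n)%N -> input_kept s ->
  wp log_prog (10 * n.+1) (fun s' => (n <= 2 ^ imem s' 13 0)%N /\
     (2 ^ (imem s' 13 0).-1 < n \/ imem s' 13 0 = 0)%N) s.
Proof.
move=> n0 ki.
pose I j s' := [/\ imem s' 13 0 = j, imem s' 14 0 = (2 ^ j)%N &
  (2 ^ j.-1 < n)%N \/ j = 0%N].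
apply: (@wp_weaken _ _ (1 + (1 + (n * 4).+1).+1).+1 _ 
  (fun s' => ~~ (beval s' (ILt (ivar 14) n_in)) /\ exists2 j, (j <= n)%N & I j s' /\ input_kept s')); last first.
- move=> s' [/= nb [j _ [[-> e14 h] ki']]] _.
  by rewrite e14 (input_n ki') -leqNgt in nb.
- by lia.
apply: (@wp_seq _ _ _ _ _ (fun s' => imem s' 13 0 = 0%N)); first exact: wp_run.
move=> s1 ss1 e1; apply: (@wp_seq _ _ _ _ _ (fun s' => I 0%N s')).
  by apply: wp_run => //; split=> //; right.
move=> s2 ss2 I2.
have ki2 : input_kept s2 by apply: same_input ss2 _ => //; apply: same_input ss1 ki.
apply: (@wp_while _ _ _ _ _ (fun j s' => I j s' /\ input_kept s')) => //.
move=> j s3 ss3 [[e13 e14 h] ki3] /=; rewrite e14 (input_n ki3) => lt; split.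
  by apply: ltn_trans lt; apply: ltn_expl.
apply: wp_run => //=; split; last first.
  by case: ki3 => h1 h2; split=> //.
split=> /=; rewrite /upd /= ?e13 ?e14 ?addn1 //.
  by rewrite expnS mul2n addnn.
by left.
Qed.

Lemma wp_size (L : nat) s : (0 < n)%N -> 0 < eps -> input_kept s -> imem s 13 0 = L ->
  let Y := 64 * 64 * L%:R * (t%:R + eps * n%:R) / (eps ^+ 2 * n%:R) : R in
  wp size_prog (10 * (Num.truncn Y).+1) (fun s' =>
    Y <= (imem s' 1 0)%:R /\ (imem s' 1 0 <= (Num.truncn Y).+1)%N) s.
Proof.
move=> n0 e0 ki e13 Y; have nR : 0 < n%:R :> R by rewrite ltr0n.
have den : 0 < eps ^+ 2 * n%:R by rewrite mulr_gt0 ?exprn_gt0.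
have Y0 : 0 <= Y.
  rewrite divr_ge0 ?(ltW den) // mulr_ge0 ?addr_ge0 ?ler0n // ?mulr_ge0 ?ler0n //.
  exact: ltW.
have testE s' : input_kept s' -> imem s' 13 0 = L ->
    beval s' (RLt (RMul (ROfInt (ivar 1)) (RMul (RMul eps_in eps_in) (ROfInt n_in)))
              (RMul (RMul (RMul (ROfInt (INum 64)) (ROfInt (INum 64))) (ROfInt (ivar 13)))
                    outlier_weight)) = ((imem s' 1 0)%:R < Y).
  move=> ki' e'; rewrite /= (input_n ki') (input_t ki') (input_eps ki') e' /Y.
  by rewrite ltr_pdivlMr // expr2.
apply: (@wp_weaken _ _ (1 + ((Num.truncn Y).+1 * 2).+1).+1 _ 
  (fun s' => ~~ beval s' (RLt (RMul (ROfInt (ivar 1)) (RMul (RMul eps_in eps_in) (ROfInt n_in)))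
              (RMul (RMul (RMul (ROfInt (INum 64)) (ROfInt (INum 64))) (ROfInt (ivar 13)))
                    outlier_weight)) /\ exists2 j, (j <= (Num.truncn Y).+1)%N &
    [/\ imem s' 1 0 = j, imem s' 13 0 = L & input_kept s'])); last first.
- move=> s' [nb [j jN [ej eL ki']]] _; split; last by rewrite ej.
  by move: nb; rewrite testE // -leNgt.
- by move: (Num.truncn Y) => N; lia.
apply: (@wp_seq _ _ _ _ _ (fun s' => imem s' 1 0 = 0%N)); first exact: wp_run.
move=> s1 ss1 e1; apply: wp_while.
  split=> //; first by rewrite (ss1.1 13%N isT).
  exact: same_input ss1 ki.
move=> j s2 ss2 [e1' eL ki2]; rewrite testE // e1' => lt; split.
  by rewrite -(ltr_nat R); apply: lt_trans lt (truncnS_gt Y).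
apply: wp_run => //=; split; rewrite /upd //= ?e1' ?addn1 //.
Qed.

Lemma wp_threshold m s : (0 < n)%N -> 4 * t%:R + eps * n%:R < 4 * n%:R ->
  0 <= 4 * t%:R + eps * n%:R :> R -> input_kept s -> imem s 1 0 = m ->
  wp threshold_prog (10 * m.+1) (fun s' => exists k,
    [/\ imem s' 2 0 = (m - k)%N, (k < m)%N \/ m = 0%N,
     k%:R * (4 * n%:R) <= m%:R * (4 * t%:R + eps * n%:R) &
     m%:R * (4 * t%:R + eps * n%:R) < k.+1%:R * (4 * n%:R)]) s.
Proof.
move=> n0 lt4 ge0 ki e1; set W := 4 * t%:R + eps * n%:R in lt4 ge0 *.
have nR : 0 < 4 * n%:R :> R by rewrite mulr_gt0 ?ltr0n.
set test := BNot (RLt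
         (RMul (ROfInt (ivar 1)) (RAdd (RMul (ROfInt (INum 4)) (ROfInt t_in))
                                       (RMul eps_in (ROfInt n_in))))
         (RMul (ROfInt (IAdd (ivar 16) (INum 1))) (RMul (ROfInt (INum 4)) (ROfInt n_in)))).
have testE s' : input_kept s' -> imem s' 1 0 = m ->
    beval s' test = ((imem s' 16 0).+1%:R * (4 * n%:R) <= m%:R * W).
  move=> ki' e'; rewrite /= (input_n ki') (input_t ki') (input_eps ki') e' /W.
  by rewrite -leNgt addn1.
pose I j s' := [/\ imem s' 16 0 = j, imem s' 1 0 = m, input_kept s' &
   j%:R * (4 * n%:R) <= m%:R * W].
have klt j : j%:R * (4 * n%:R) <= m%:R * W -> (j < m)%N \/ m = 0%N.
  move=> h; case: (posnP m) => [|m0]; [by right | left].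
  have h2 : m%:R * W < m%:R * (4 * n%:R) by rewrite ltr_pM2l ?ltr0n.
  by have := le_lt_trans h h2; rewrite ltr_pM2r // ltr_nat.
apply: (@wp_weaken _ _ (1 + ((m * 2).+1 + 1).+1).+1 _ (fun s' => exists k,
    [/\ imem s' 2 0 = (m - k)%N, (k < m)%N \/ m = 0%N,
     k%:R * (4 * n%:R) <= m%:R * W & m%:R * W < k.+1%:R * (4 * n%:R)])) => //; last by lia.
apply: (@wp_seq _ _ _ _ _ (fun s' => imem s' 16 0 = 0%N)); first exact: wp_run.
move=> s1 ss1 e16.
apply: (@wp_seq _ _ _ _ _ (fun s' => ~~ beval s' test /\ exists2 j, (j <= m)%N & I j s')).
  apply: wp_while.
    split=> //; first by rewrite (ss1.1 1%N isT).
      exact: same_input ss1 ki.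
    by rewrite mul0r mulr_ge0 ?ler0n.
  move=> j s2 ss2 [ej em ki2 h]; rewrite testE // ej => le; split.
    case: (klt _ le) => [|m0]; first exact: ltn_trans.
    by move: le; rewrite m0 mul0r pmulr_lle0 // lern0.
  apply: wp_run => //=; split; rewrite /upd //= ?ej ?addn1 //.
move=> s2 ss2 [nb [j jm [ej em ki2 h]]]; apply: wp_run => //=.
exists j; rewrite /upd /= ej em; split=> //; first exact: klt.
by move: nb; rewrite testE // ej -ltNge.
Qed.

Definition sample_of w : seq (R * R) := [seq nth (0, 0) X v | v <- w].

(** [u] is the word drawn so far and [d] the number of draws left; the bound is the mean of [pi]
    over all completions of [u]. *)
Lemma ok_draw_loop m sz d u s k N E (pi : seq nat -> R) :
  (0 < n)%N -> (size u + d = m)%N -> all (ltn^~ n) u -> input_kept s ->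
  imem s 1 0 = m -> imem s 2 0 = sz -> imem s 7 0 = size u ->
  (forall i, (i < size u)%N -> rmem s 4 i = (nth (0, 0) (sample_of u) i).1 /\
     rmem s 5 i = (nth (0, 0) (sample_of u) i).2) ->
  (forall w s', size w = m -> all (ltn^~ n) w -> data (sample_of w) sz s' ->
     ok N (k, s') E (pi w)) ->
  ok (d * 8 + 1 + N)
     (While (ILt (ivar 7) (ivar 1))
        (Seq draw_body (ISet 7 (INum 0) (IAdd (ivar 7) (INum 1)))) :: k, s) E
     (avg n d (fun w => pi (u ++ w))).
Proof.
move=> n0; elim: d u s => [|d IH] u s um un ki e1 e2 e7 eu H.
  rewrite /= cats0 add0n add1n; apply: (@ok_step _ _ _ _ _ (k, s)).
    by rewrite /succs /= e7 e1 -um addn0 ltnn.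
  apply: H => //; first by rewrite -um addn0.
  by split=> //; rewrite ?e1 size_map // -um addn0.
have lt : (size u < m)%N by rewrite -um addnS ltnS leq_addr.
rewrite [(d.+1 * 8)%N]mulSn -!addnA [X in ok X](_ : _ = (3 + (d * 8 + 1 + N) + 4).+1); last by lia.
apply: ok_step; first by rewrite /succs /= e7 e1 lt.
rewrite addn4; apply: ok_seq; apply: ok_seq.
rewrite [avg _ _ _]/=.
have en : (ieval s (ISub n_in (INum 1))).+1 = n.
  by rewrite [ieval _ _]/= (input_n ki) subn1 prednK.
have := @ok_rand _ (3 + (d * 8 + 1 + N)).+1 15 (INum 0) (ISub n_in (INum 1))
  (copy_point (ivar 7) (ivar 15) :: ISet 7 (INum 0) (IAdd (ivar 7) (INum 1)) ::
    While (ILt (ivar 7) (ivar 1))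
        (Seq draw_body (ISet 7 (INum 0) (IAdd (ivar 7) (INum 1)))) :: k) s E
  (fun v => avg n d (fun w => pi (u ++ v :: w))).
rewrite en; apply=> v; rewrite -ltnS en => vn.
rewrite -addSn; apply: (@wp_ok _ _ 3 (fun s' => rmem s' 4 = upd (rmem s) 4 (size u) (nth (0, 0) X v).1 4
   /\ rmem s' 5 = upd (rmem s) 5 (size u) (nth (0, 0) X v).2 5)).
  apply: wp_run => //; rewrite /copy_point /= /upd /= e7 (input_x _ ki) (input_y _ ki).
  by split; apply/funext => i.
move=> s1 ss1 [r4 r5].
have ki1 : input_kept s1.
  by apply: same_input ss1 _ => //; case: ki => h1 h2; split=> // a a2; exact: h2.
rewrite -add1n -addnA add1n; apply: ok_step; first by rewrite /succs /=.
have -> : (fun w => pi (u ++ v :: w)) = (fun w => pi (rcons u v ++ w)).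
  by apply/funext => w; rewrite cat_rcons.
have e71 : imem s1 7 0 = size u by rewrite (ss1.1 7%N isT).
rewrite addnA; apply: IH => //=.
- by rewrite size_rcons addSn -addnS.
- by rewrite all_rcons vn.
- by rewrite /upd /= (ss1.1 1%N isT).
- by rewrite /upd /= (ss1.1 2%N isT).
- by rewrite /upd /= e71 size_rcons addn1.
move=> i; rewrite size_rcons ltnS /sample_of map_rcons nth_rcons size_map leq_eqVlt r4 r5 /upd /=.
by case: (i =P size u) => [-> _|_ /= iu]; rewrite ?ltnn ?eqxx // iu; apply: eu.
Qed.

Lemma ok_draw m sz s k N E (pi : seq nat -> R) :
  (0 < n)%N -> input_kept s -> imem s 1 0 = m -> imem s 2 0 = sz ->
  (forall w s', size w = m -> all (ltn^~ n) w -> data (sample_of w) sz s' ->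
     ok N (k, s') E (pi w)) ->
  ok (m * 8 + 3 + N) (draw_prog :: k, s) E (avg n m pi).
Proof.
move=> n0 ki e1 e2 H.
rewrite [X in ok X](_ : _ = (m * 8 + 1 + N).+2); last by lia.
apply: ok_seq; apply: ok_step; first by [].
apply: (@ok_draw_loop m sz m [::]) => //.
Qed.

End Main.

(** * Failure probability of the sample *)

Section Final.
Variable R : realType.
Implicit Types (eps : R) (n m k t L : nat) (c : pred nat) (w : seq nat).

Lemma expRN1_le : expR (- 1) <= 2^-1 :> R.
Proof.
rewrite expRN lef_pV2 ?posrE ?expR_gt0 //.
by have := expR_ge1Dx (1 : R); rewrite -[1 + 1]/(2%:R).
Qed.

Lemma expR_half_le : expR (2^-1) <= 2 :> R.
Proof.
rewrite -[2^-1]opprK expRN -[leRHS]invrK lef_pV2 ?posrE ?expR_gt0 ?invr_gt0 //.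
apply: le_trans (expR_ge1Dx _); lra.
Qed.

(** From [exp (1 / 2) <= 2]: the binary logarithm exceeds the natural one by a factor of at most
    2. *)
Lemma ln_nat_ge n L : (2 ^ L <= n)%N -> (0 < n)%N -> L%:R / 2 <= ln n%:R :> R.
Proof.
move=> le n0; have nR : 0 < n%:R :> R by rewrite ltr0n.
rewrite -ler_expR lnK ?posrE // mulrC expRM_natr.
apply: (@le_trans _ _ (2 ^+ L)).
  by rewrite lerXn2r ?nnegrE ?expR_ge0 // expR_half_le.
by rewrite -natrX ler_nat.
Qed.

Definition separation_failure n t k eps c w : bool :=
  ((count c (iota 0 n) <= t + 2)%N && (k < count c w)%N) ||
  ((t%:R + 3 / 8 * eps * n%:R <= (count c (iota 0 n))%:R) && (count c w <= k)%N).

Lemma avg_separation_failure n m t k eps c : (0 < n)%N -> 0 < eps ->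
  16 <= eps * n%:R ->
  k%:R * (4 * n%:R) <= m%:R * (4 * t%:R + eps * n%:R) ->
  m%:R * (4 * t%:R + eps * n%:R) < k.+1%:R * (4 * n%:R) ->
  avg n m (fun w => (separation_failure n t k eps c w)%:R) <=
  expR (- (m%:R * eps ^+ 2 / (512 * (t%:R / n%:R + eps)))).
Proof.
move=> n0 e0 big hk hk'; have nR : 0 < n%:R :> R by rewrite ltr0n.
have n1 : n%:R != 0 :> R by rewrite gt_eqF.
set x := t%:R / n%:R; have x0 : 0 <= x by rewrite divr_ge0.
have ex : x * n%:R = t%:R by rewrite divfK.
have p0 : x + eps != 0 by rewrite gt_eqF // ltr_wpDl.
have eW : 4 * t%:R + eps * n%:R = (x + eps / 4) * (4 * n%:R).
  by rewrite -ex; field.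
have n4 : 0 < 4 * n%:R :> R by rewrite mulr_gt0.
rewrite eW [m%:R * _]mulrA ler_pM2r // in hk; rewrite eW [m%:R * _]mulrA ltr_pM2r // in hk'.
have -> : m%:R * eps ^+ 2 / (512 * (x + eps)) =
    m%:R * (eps / 8) ^+ 2 / (8 * (x + eps)) by field.
rewrite /separation_failure; set f := count c (iota 0 n).
(* The two kinds of failure exclude each other, as [2 < 3 eps n / 8], so a single tail bound
   suffices for each range. Between the two levels no failure is possible. *)
case: (leqP f (t + 2)) => ft /=.
  have -> : (t%:R + 3 / 8 * eps * n%:R <= f%:R) = false.
    apply/negbTE; rewrite -ltNge; have : f%:R <= t%:R + 2 :> R by rewrite -natrD ler_nat.
    by clear -big; lra.
  under [X in avg _ _ X]funext => w do rewrite orbF.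
  apply: (@tail_upper _ n m k c (eps / 8) (x + eps) (x + eps / 4) (x + eps / 8)) => //.
  - by rewrite divr_gt0.
  - by clear -x0 e0; lra.
  - by clear -x0 e0; lra.
  - by clear -x0 e0; lra.
  - have : f%:R <= t%:R + 2 :> R by rewrite -natrD ler_nat.
    by rewrite -/f mulrDl ex; clear -big; lra.
  - by clear -x0 e0; lra.
  - exact: ltW.
case: (leP (t%:R + 3 / 8 * eps * n%:R) f%:R) => ft' /=.
  apply: (@tail_lower _ n m k c (eps / 8) (x + eps) (x + eps / 4) (x + 3 / 8 * eps)) => //.
  - by rewrite divr_gt0.
  - by clear -x0 e0; lra.
  - by clear -x0 e0; lra.
  - by clear -x0 e0; lra.
  - by rewrite -/f mulrDl ex.
  - by clear -x0 e0; lra.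
apply: (@le_trans _ _ (avg n m (fun=> 0 * 0 : R))).
  by apply: avg_le => w _ _; rewrite mul0r.
by rewrite avg_scale mulr0 expR_ge0.
Qed.

Lemma failure_bound n m t L eps : (0 < n)%N -> 0 < eps -> (n <= 2 ^ L)%N ->
  64 * 64 * L%:R * (t%:R + eps * n%:R) / (eps ^+ 2 * n%:R) <= m%:R ->
  expR (- (m%:R * eps ^+ 2 / (512 * (t%:R / n%:R + eps)))) <= (n%:R ^+ 6)^-1.
Proof.
move=> n0 e0 nL hm; have nR : 0 < n%:R :> R by rewrite ltr0n.
have n1 : n%:R != 0 :> R by rewrite gt_eqF.
have W0 : 0 < t%:R + eps * n%:R by rewrite ltr_wpDl ?mulr_gt0.
have eW : t%:R / n%:R + eps = (t%:R + eps * n%:R) / n%:R by field.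
rewrite ler_pdivrMr ?mulr_gt0 ?exprn_gt0 // in hm.
(* [64 * 64 = 8 * 512], so the exponent is even at least [8 L]; 6 is what the union over [2 n^5]
   ranges calls for. *)
have h : L%:R * 6 <= m%:R * eps ^+ 2 / (512 * (t%:R / n%:R + eps)).
  rewrite eW; set W := t%:R + eps * n%:R in W0 hm *.
  have -> : m%:R * eps ^+ 2 / (512 * (W / n%:R)) = m%:R * (eps ^+ 2 * n%:R) / (512 * W).
    by field; rewrite n1 gt_eqF.
  rewrite ler_pdivlMr ?mulr_gt0 //; apply: le_trans hm.
  have := mulr_ge0 (ler0n R L) (ltW W0); clear; lra.
apply: (@le_trans _ _ (expR (- 1 * (L%:R * 6)))).
  by rewrite ler_expR mulN1r lerN2.
rewrite mulrA expRM_natr expRM_natr -exprVn lerXn2r ?nnegrE ?exprn_ge0 ?expR_ge0 ?invr_ge0 //.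
apply: (@le_trans _ _ (2^-1 ^+ L)).
  by rewrite lerXn2r ?nnegrE ?expR_ge0 ?invr_ge0 // expRN1_le.
by rewrite exprVn lef_pV2 ?posrE ?exprn_gt0 // -natrX ler_nat.
Qed.

Section Main.
Variables (X : seq (R * R)) (t : nat) (eps : R).

(** The boolean distinguishes the closed from the laterally open box, which doubles the [n^5]
    choices of points. *)
Definition ranges : seq (bool * (R * R) * (R * R) * (R * R) * (R * R) * (R * R)) :=
  [seq (a, y) | a <-
  [seq (a, x) | a <-
  [seq (a, z) | a <-
  [seq (a, q) | a <-
  [seq (b, p) | b <- [:: true; false], p <- X], q <- X], z <- X], x <- X], y <- X].

Lemma size_ranges : size ranges = (2 * size X ^ 5)%N.
Proof. by rewrite !size_allpairs !expnS expn0 /=; lia. Qed.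

Definition outside (r : bool * (R * R) * (R * R) * (R * R) * (R * R) * (R * R)) : pred nat :=
  let: (b, p, q, z, x, y) := r in
  fun v => ~~ in_range b (cand_of p q z x y) (nth (0, 0) X v).

Definition no_failure k w : bool :=
  all (fun r => ~~ separation_failure (size X) t k eps (outside r) w) ranges.

Lemma no_failure_faithful k w : no_failure k w -> faithful X t eps (sample_of X w) k.
Proof.
move=> /allP h b p q z x y pX qX zX xX yX.
have rX : (b, p, q, z, x, y) \in ranges.
  do 4 ! (apply: allpairs_f => //).
  by apply: allpairs_f => //; case: b.
have := h _ rX; rewrite /separation_failure.
set c := outside _; set out := predC _.
have -> : count c (iota 0 (size X)) = count out X by rewrite (count_nth_iota (0, 0) out).
have -> : count c w = count out (sample_of X w) by rewrite count_map.
rewrite negb_or !negb_and => /andP[/orP h1 /orP h2]; split.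
  by move=> le; case: h1; rewrite ?le // -leqNgt.
by move=> le; case: h2; rewrite ?le // -ltnNge.
Qed.

Lemma avg_no_failure m k L : (0 < size X)%N -> 0 < eps ->
  16 <= eps * (size X)%:R -> (size X <= 2 ^ L)%N ->
  64 * 64 * L%:R * (t%:R + eps * (size X)%:R) / (eps ^+ 2 * (size X)%:R) <= m%:R ->
  k%:R * (4 * (size X)%:R) <= m%:R * (4 * t%:R + eps * (size X)%:R) ->
  m%:R * (4 * t%:R + eps * (size X)%:R) < k.+1%:R * (4 * (size X)%:R) ->
  1 - 3 / (size X)%:R <= avg (size X) m (fun w => (no_failure k w)%:R : R).
Proof.
move=> n0 e0 big nL hm hk hk'; have nR : 0 < (size X)%:R :> R by rewrite ltr0n.
apply: le_trans (avg_all (beta := ((size X)%:R ^+ 6)^-1) ranges n0 _); last first.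
  move=> r; apply: le_trans (avg_separation_failure _ n0 e0 big hk hk') _.
  exact: failure_bound hm.
rewrite size_ranges natrM natrX; set x := (size X)%:R in nR *.
have -> : 2 * x ^+ 5 * (x ^+ 6)^-1 = 2 / x by field; rewrite gt_eqF.
by rewrite lerD2l lerN2 ler_pM2r ?invr_gt0 // ler_nat.
Qed.

End Main.
End Final.

(** * Running time *)

Section Modes.
Variable R : realType.
Implicit Types (X : seq (R * R)) (t : nat) (eps : R) (s : store R).

Lemma ok_done N s (E : store R -> Prop) (pi : R) :
  pi <= (`[< E s >])%:R -> ok N ([::], s) E pi.
Proof. by case: N. Qed.

Lemma ok_exact_mode X t eps (E : store R -> Prop) :
  uniq X -> no_three_collinear X -> (2 * t < size X)%N -> 0 < eps < 1 ->
  eps * (size X)%:R < 16 -> (forall s, good X t eps (output s) -> E s) ->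
  ok (10 * (size X).+1 + 300 * (size X).+1 ^ 4 + 4) (init main_prog X t eps) E
     (1 - 3 / (size X)%:R).
Proof.
move=> uX nX tX e01 small gE.
have n0 : (0 < size X)%N by lia.
have -> : (10 * (size X).+1 + 300 * (size X).+1 ^ 4 + 4 =
  ((10 * (size X).+1).+1 + (300 * (size X).+1 ^ 4 + 2)).+1)%N by lia.
apply: ok_seq; apply: (@wp_ok _ _ _ (data X (size X - t))).
  apply: wp_if; rewrite [beval _ _]/= small // => _.
  exact: wp_exact.
move=> s1 _ ds; have sz0 : (0 < size X - t)%N by lia.
apply: (wp_ok (wp_core sz0 ds)) => s2 _ bs; apply: ok_done.
(* For [n <= 3] the claimed probability [1 - 3 / n] is not positive. *)
case: (ltnP (size X) 4) => X4.
  apply: (@le_trans _ _ 0); last exact: ler0n.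
  rewrite subr_le0 ler_pdivlMr ?ltr0n // mul1r (ler_nat _ _ 3); lia.
have -> : `[< E s2 >] = true by apply/asboolP; apply: gE; exact: good_exact bs.
by rewrite gerBl divr_ge0.
Qed.

Lemma ok_sample_mode X t eps (E : store R -> Prop) :
  uniq X -> no_three_collinear X -> (2 * t < size X)%N -> 0 < eps < 1 ->
  16 <= eps * (size X)%:R -> (forall s, good X t eps (output s) -> E s) ->
  exists T m L, [/\ (T <= 10 * (size X).+1 + 400 * m.+1 ^ 4)%N,
    (2 ^ L.-1 < size X)%N, (0 < L)%N,
    m%:R <= 64 * 64 * L%:R * (t%:R + eps * (size X)%:R) / (eps ^+ 2 * (size X)%:R) + 1 &
    ok T (init main_prog X t eps) E (1 - 3 / (size X)%:R)].
Proof.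
move=> uX nX tX /andP[e0 e1] big gE.
have n0 : (0 < size X)%N by lia.
have nR : 0 < (size X)%:R :> R by rewrite ltr0n.
have n16 : 16 < (size X)%:R :> R by clear -big e1 nR; nra.
have tXR : 2 * t%:R + 1 <= (size X)%:R :> R by rewrite -natrM natr1 ler_nat.
have ki0 : input_kept X t eps (input X t eps) by [].
(* The parameters [m] and [k] are computed before any draw, so they are fixed once and the mean runs
   over words of one length. *)
have [t1 [s1 [l1 x1 [nL hL]]]] := wp_log n0 ki0.
have ki1 : input_kept X t eps s1 by apply: same_input (exec_same x1) ki0.
set L := imem s1 13 0 in nL hL.
have L0 : (0 < L)%N.
  rewrite lt0n; apply/eqP => L0; rewrite L0 expn0 in nL.
  by move: n16; rewrite (ltr_nat _ 16) => /leq_trans /(_ nL).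
have [t2 [s2 [l2 x2 [hY mN]]]] := wp_size n0 e0 ki1 (erefl L).
have ki2 : input_kept X t eps s2 by apply: same_input (exec_same x2) ki1.
set Y := _ / _ in l2 hY mN; set m := imem s2 1 0 in hY mN.
have Y0 : 0 < Y.
  by rewrite divr_gt0 ?mulr_gt0 ?exprn_gt0 ?ltr0n // ltr_wpDl ?mulr_gt0.
have m0 : (0 < m)%N by rewrite -(ltr0n R); apply: lt_le_trans hY.
have Nm : (Num.truncn Y <= m)%N.
  by rewrite -(ler_nat R); apply: le_trans hY; rewrite truncn_le ltW.
have mY : m%:R <= Y + 1.
  apply: (@le_trans _ _ (Num.truncn Y).+1%:R); first by rewrite ler_nat.
  by rewrite -natr1 lerD2r truncn_le ltW.
have W4 : 4 * t%:R + eps * (size X)%:R < 4 * (size X)%:R.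
  by clear -e1 tXR nR; nra.
have W0 : 0 <= 4 * t%:R + eps * (size X)%:R by rewrite addr_ge0 // mulr_ge0 ?ler0n // ltW.
have [t3 [s3 [l3 x3 [k [esz km hk hk']]]]] := wp_threshold n0 W4 W0 ki2 (erefl m).
have ki3 : input_kept X t eps s3 by apply: same_input (exec_same x3) ki2.
have {}km : (k < m)%N by case: km => // em; rewrite em in m0.
have sz0 : (0 < m - k)%N by rewrite subn_gt0.
have em : imem s3 1 0 = m by rewrite (exec_imem x3).
exists (t1 + (t2 + (t3 + (m * 8 + 3 + (300 * m.+1 ^ 4 + 0))).+1).+1).+3, m, L.
split=> //.
- have : (m.+1 <= m.+1 ^ 4)%N by rewrite -[X in (X <= _)%N]expn1 leq_exp2l.
  by move: (m.+1 ^ 4)%N Nm l1 l2 l3; clear; lia.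
- by case: hL => // L00; rewrite L00 in L0.
have large : beval (input X t eps)
    (RLt (RMul eps_in (ROfInt n_in)) (ROfInt (INum 16))) = false.
  by apply/negbTE; rewrite -leNgt; exact: big.
apply: ok_seq; apply: ok_if; rewrite large.
apply: ok_seq; apply: (exec_ok x1); apply: ok_seq; apply: (exec_ok x2).
apply: ok_seq; apply: (exec_ok x3).
have [h] : ok (m * 8 + 3 + (300 * m.+1 ^ 4 + 0)) ([:: draw_prog; core_prog], s3) E
   (avg (size X) m (fun w => (no_failure X t eps k w)%:R)).
  apply: (ok_draw n0 ki3 em esz) => w s' ew aw ds.
  have eS : size (sample_of X w) = m by rewrite size_map.
  rewrite -[in X in ok X]eS; apply: (wp_ok (wp_core sz0 ds)) => s'' _ bs.
  apply: ok_done; case: (boolP (no_failure X t eps k w)) => [good_w|_]; last exact: ler0n.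
  have -> : `[< E s'' >] = true; last by [].
  apply/asboolP; apply: gE; apply: (@good_sample _ X t eps (sample_of X w) k) => //.
  - by rewrite e0.
  - move=> x /mapP[v vw ->]; apply: mem_nth; exact: (allP aw).
  - by rewrite eS.
  - exact: no_failure_faithful.
  - by rewrite eS.
by move=> h'; split=> //; apply: le_trans h'; exact: (avg_no_failure n0 e0 big nL hY hk hk').
Qed.

(** The first summand pays for the search on a sample, the second for the exact search, and the last
    for the terms linear in [n]. *)
Definition time_constant : R :=
  400 * (162 * (4 * (64 * 64)) ^+ 4) + 300 * 16 ^+ 6 + (300 * 16 + 100).

Definition budget n t eps : R :=
  (ln n%:R / eps ^+ 2) ^+ 4 * (t%:R / n%:R + eps) ^+ 3.

Lemma budget_ge0 n t eps : (0 < n)%N -> 0 < eps -> 0 <= budget n t eps.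
Proof.
move=> n0 e0; rewrite mulr_ge0 // exprn_ge0 ?addr_ge0 ?divr_ge0 ?(ltW e0) ?sqr_ge0 //.
by rewrite ln_ge0 // ler1n.
Qed.

(** [n < 16 / eps] bounds [n^4] by [16^4 eps^-4], while [ln n >= 1 / 2] and [p >= eps] give a budget
    of at least [eps^-5 / 16]. For [n = 1] the logarithm vanishes and the linear term pays. *)
Lemma time_exact n t eps : (0 < n)%N -> 0 < eps < 1 -> eps * n%:R < 16 ->
  (10 * n.+1 + 300 * n.+1 ^ 4 + 4)%:R <= time_constant * (budget n t eps + n%:R).
Proof.
move=> n0 /andP[e0 e1] small; have B0 := budget_ge0 t n0 e0.
have nR : 1 <= n%:R :> R by rewrite ler1n.
have K1 : 0 <= 400 * (162 * (4 * (64 * 64)) ^+ 4) :> R by rewrite !mulr_ge0 // exprn_ge0 ?mulr_ge0.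
have K2 : 0 <= 16 ^+ 6 :> R by rewrite exprn_ge0.
have h : (n%:R + 1) ^+ 4 <= 16 ^+ 6 * budget n t eps + 16 * n%:R.
  case: (ltnP 1 n) => n2; last first.
    have -> : n = 1%N by clear -n0 n2; lia.
    have -> : (1 + 1) ^+ 4 = 16 * 1 :> R by ring.
    by rewrite lerDr mulr_ge0 // budget_ge0.
  apply: (@le_trans _ _ ((2 * n%:R) ^+ 4)).
    rewrite lerXn2r ?nnegrE ?addr_ge0 ?mulr_ge0 //; lra.
  apply: (@le_trans _ _ (16 ^+ 6 * budget n t eps)); last by rewrite lerDl mulr_ge0.
  have -> : (2 * n%:R) ^+ 4 = 16 * n%:R ^+ 4 :> R by ring.
  rewrite (exprS 16 5) -mulrA ler_pM2l //.
  have ie0 : 0 < eps^-1 by rewrite invr_gt0.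
  apply: (@le_trans _ _ ((16 / eps) ^+ 4)).
    rewrite lerXn2r ?nnegrE ?divr_ge0 ?(ltW e0) //.
    by rewrite ler_pdivlMr // mulrC ltW.
  rewrite exprMn (exprSr 16 4) -mulrA ler_pM2l ?exprn_gt0 //.
  have ln2 : 2^-1 <= ln n%:R :> R.
    by rewrite -[2^-1]mul1r; apply: (@ln_nat_ge R n 1).
  have step : (2^-1 / eps ^+ 2) ^+ 4 * eps ^+ 3 <= budget n t eps.
    apply: ler_pM.
    - by rewrite exprn_ge0 // divr_ge0 ?sqr_ge0 ?invr_ge0.
    - by rewrite exprn_ge0 // ltW.
    - rewrite lerXn2r ?nnegrE ?divr_ge0 ?sqr_ge0 ?invr_ge0 //.
        by apply: le_trans ln2; rewrite invr_ge0.
      by rewrite ler_wpM2r ?invr_ge0 ?sqr_ge0.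
    - by rewrite lerXn2r ?nnegrE ?addr_ge0 ?divr_ge0 ?(ltW e0) // lerDr divr_ge0.
  apply: le_trans (ler_wpM2l _ step) => //.
  have -> : 16 * ((2^-1 / eps ^+ 2) ^+ 4 * eps ^+ 3) = eps^-1 ^+ 4 * eps^-1.
    by field; rewrite gt_eqF.
  by rewrite ler_peMr ?exprn_ge0 ?(ltW ie0) // -invr1 lef_pV2 ?posrE // ltW.
rewrite 2!natrD (natrM _ 10) (natrM _ 300) natrX -[n.+1%:R]natr1 /time_constant.
set q := (n%:R + 1) ^+ 4 in h *; set u := 16 ^+ 6 in h K2 *.
set a := 400 * _ in K1 *; set B := budget n t eps in h B0 *.
have := mulr_ge0 K1 B0; have := mulr_ge0 K1 (le_trans ler01 nR).
have := mulr_ge0 K2 (le_trans ler01 nR); move: (n%:R : R) nR h => x nR h.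
by clearbody q u a B; clear -B0 nR h; lra.
Qed.

(** Since [Y >= 1], [m + 1 <= Y + 2 <= 3 Y], so the search costs [O((ln n / eps^2)^4 p^4)]; the
    surplus factor [p] is at most 2, and [162 = 81 * 2]. *)
Lemma time_sample n t eps m L (T : nat) : (2 * t < n)%N -> 0 < eps < 1 ->
  (T <= 10 * n.+1 + 400 * m.+1 ^ 4)%N -> (2 ^ L.-1 < n)%N -> (0 < L)%N -> (1 < n)%N ->
  m%:R <= 64 * 64 * L%:R * (t%:R + eps * n%:R) / (eps ^+ 2 * n%:R) + 1 ->
  T%:R <= time_constant * (budget n t eps + n%:R).
Proof.
move=> tn /andP[e0 e1] hT hL L0 n1 hm; have n0 : (0 < n)%N by exact: ltnW.
have B0 := budget_ge0 t n0 e0.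
have nR : 1 <= n%:R :> R by rewrite ler1n.
have nR0 : 0 < n%:R :> R by rewrite ltr0n.
have K1 : 0 <= 400 * (162 * (4 * (64 * 64)) ^+ 4) :> R by rewrite !mulr_ge0 // exprn_ge0 ?mulr_ge0.
have K2 : 0 <= 16 ^+ 6 :> R by rewrite exprn_ge0.
set A := 4 * (64 * 64) in K1 *; have A0 : 0 <= A by rewrite !mulr_ge0.
set p := t%:R / n%:R + eps.
have p0 : eps <= p by rewrite lerDr divr_ge0.
have tnR : t%:R / n%:R <= 1 :> R.
  by rewrite ler_pdivrMr // mul1r ler_nat; clear -tn; lia.
have p2 : p <= 2 by rewrite /p; lra.
have pp : 0 < p by exact: lt_le_trans p0.
set Z := ln n%:R / eps ^+ 2.
(* Rounding up the binary logarithm costs at most one, which is absorbed by [1 <= 2 ln n] for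
   [n >= 2]. *)
have lnL : L%:R <= 4 * ln n%:R :> R.
  have h1 : L.-1%:R / 2 <= ln n%:R :> R by apply: ln_nat_ge => //; exact: ltnW.
  have h2 : 1%:R / 2 <= ln n%:R :> R by apply: ln_nat_ge.
  by rewrite -(prednK L0) -natr1; lra.
have Z0 : 0 <= Z by rewrite divr_ge0 ?sqr_ge0 // ln_ge0.
set Y := _ / _ in hm.
have eY : Y = 64 * 64 * L%:R * p / eps ^+ 2.
  by rewrite /Y /p; field; rewrite !gt_eqF.
have Y1 : 1 <= Y.
  rewrite eY ler_pdivlMr ?exprn_gt0 // mul1r.
  have : 1 * eps <= L%:R * p by rewrite ler_pM ?ler1n // ltW.
  have e2 : eps ^+ 2 <= eps by rewrite expr2 ler_piMr // ltW.
  have LpR : 0 <= L%:R * p by rewrite mulr_ge0 // ltW.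
  by clear -e2 LpR; lra.
have YZ : Y <= A * Z * p.
  rewrite eY /Z /A.
  have -> : 4 * (64 * 64) * (ln n%:R / eps ^+ 2) * p = 64 * 64 * (4 * ln n%:R) * p / eps ^+ 2 by ring.
  rewrite ler_wpM2r ?invr_ge0 ?sqr_ge0 // ler_wpM2r ?(ltW pp) //.
  by rewrite ler_wpM2l // mulr_ge0.
have h : (m%:R + 1) ^+ 4 <= 162 * A ^+ 4 * budget n t eps.
  apply: (@le_trans _ _ ((3 * (A * Z * p)) ^+ 4)).
    have D0 : 0 <= A * Z * p by rewrite mulr_ge0 ?(ltW pp) // mulr_ge0.
    rewrite lerXn2r ?nnegrE ?addr_ge0 //; first by rewrite mulr_ge0.
    by move: (A * Z * p) YZ => D YZ; clearbody Y; clear -hm Y1 YZ; lra.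
  have -> : (3 * (A * Z * p)) ^+ 4 = 81 * A ^+ 4 * (Z ^+ 4 * p ^+ 3) * p by ring.
  have -> : 162 * A ^+ 4 * budget n t eps = 81 * A ^+ 4 * (Z ^+ 4 * p ^+ 3) * 2.
    by rewrite /budget -/Z -/p; ring.
  apply: ler_wpM2l => //; apply: mulr_ge0.
    by apply: mulr_ge0 => //; apply: exprn_ge0.
  by apply: mulr_ge0; apply: exprn_ge0 => //; apply: ltW.
have {}hT : T%:R <= 10 * (n%:R + 1) + 400 * (m%:R + 1) ^+ 4 :> R.
  by rewrite !natr1 -natrX -!natrM -natrD ler_nat.
rewrite /time_constant -/A; set q := (m%:R + 1) ^+ 4 in h hT.
set u := 16 ^+ 6 in K2 *; set a := 162 * _ in h K1 *; set B := budget n t eps in h B0 *.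
have := mulr_ge0 K1 (le_trans ler01 nR).
have := mulr_ge0 K2 (le_trans ler01 nR); have := mulr_ge0 K2 B0.
move: (n%:R : R) nR hT => x nR hT.
by clearbody q u a B; clear -B0 nR h hT; lra.
Qed.

End Modes.

Theorem theorem2 (R : realType) :
  exists (p : cmd) (C : R), 0 < C /\
  forall (n t : nat) (X : n.-tuple (R * R)%type) (eps : R),
    uniq X -> no_three_collinear X -> (2 * t < n)%N -> 0 < eps < 1 ->
    exists T : nat,
      [/\ T%:R <= C * ((ln n%:R / eps ^+ 2) ^+ 4 * (t%:R / n%:R + eps) ^+ 3
                       + n%:R),
          halts_within T (init p X t eps) &
          1 - 3 / n%:R <=
          prob_within T (init p X t eps) (fun s =>
            let r := output s in
            [/\ is_rect r, area r <= opt X t &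
                (n%:R - t%:R) * (1 - eps) <= (enclosed r X)%:R
                  <= n%:R - t%:R + (1 : R)])].
Proof.
exists main_prog, (time_constant R); split.
  by rewrite ltr_wpDl ?addr_ge0 ?mulr_ge0 ?exprn_ge0 ?mulr_ge0 // addr_gt0 ?mulr_gt0.
move=> n t X eps uX nX tn e01; set E := fun s : store R => _.
have n0 : (0 < n)%N by lia.
have eX : size X = n by exact: size_tuple.
have gE s : good X t eps (output s) -> E s by rewrite /good eX.
have en : 1 - 3 / n%:R = 1 - 3 / (size X)%:R :> R by rewrite eX.
rewrite -eX in tn; rewrite en.
case: (ltP (eps * (size X)%:R) 16) => big.
  have [h1 h2] := ok_exact_mode uX nX tn e01 big gE.
  exists (10 * (size X).+1 + 300 * (size X).+1 ^ 4 + 4)%N.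
  split=> //; have := time_exact t _ e01 big; rewrite {2 3}eX.
  by move/(_ (leq_ltn_trans (leq0n _) tn)); rewrite /budget eX.
have [T [m [L [hT hL L0 hm [h1 h2]]]]] := ok_sample_mode uX nX tn e01 big gE.
exists T; split=> //; have := time_sample tn e01 hT hL L0 _ hm; rewrite /budget eX; apply.
have /andP[e0 e1] := e01; rewrite -(ltr_nat R) -eX.
by clear -big e1 e0; have := ler0n R (size X); nra.
Qed.
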